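(* Fix $m,n\in\omega\setminus\{0,1\}$ and $k\in\omega\setminus\{0\}$. The following are provable in $\mathsf{ZF}$: (1) $\mathsf{RRT}^{m}_{n}$ implies $\mathsf{AC}_{2}^{-}$. (2) $\mathsf{RRT}^{2k+1}_{r}$ implies $\mathsf{AC}_{n}^{-}$ for all natural numbers $r\geq \binom{n}{2}^{k}\, n\,(k+1)$. (3) $\mathsf{RRT}^{2k}_{r}$ implies $\mathsf{AC}_{n}^{-}$ for all natural numbers $r\geq \binom{n}{2}^{k-1}\, n^{2}\binom{k+1}{2}$. (4) $\mathsf{RRT}^{2}_{3}$ implies $\mathsf{AC}_{3}^{-}$.
   Context: $\omega$ is the set of natural numbers; $[X]^{m}$ is the set of $m$-element subsets of $X$. A coloring $\chi:[X]^{m}\to C$ is $n$-bounded if $|\chi^{-1}[\{c\}]|\leq n$ for each $c\in C$. A set $Z\subseteq X$ is polychromatic for $\chi$ if distinct members of $[Z]^{m}$ receive distinct colors. $\mathsf{RRT}^{m}_{n}$: if $X$ is an infinite set and $\chi:[X]^{m}\to C$ is an $n$-bounded coloring for some infinite set $C$, then there is an infinite set $Y\subseteq X$ which is polychromatic for $\chi$. $\mathsf{AC}_{n}^{-}$: every infinite family $\mathcal{A}$ of $n$-element sets has an infinite subfamily $\mathcal{B}\subseteq\mathcal{A}$ with a choice function. $\mathsf{ZF}$ is Zermelo–Fraenkel set theory without the Axiom of Choice. *)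

(* Defs.v *)
From mathcomp Require Import all_boot.

Set Implicit Arguments.
Unset Strict Implicit.
Unset Printing Implicit Defensive.

(** First-order logic with equality over the single binary relation symbol
    [∈], with de Bruijn indices.  There are no function symbols, so the terms
    are exactly the variables, i.e. natural numbers. *)

Inductive form : Type :=
| FMem of nat & nat
| FEq of nat & nat
| FBot
| FImp of form & form
| FAll of form.

Definition FNeg p := FImp p FBot.
Definition FAnd p q := FNeg (FImp p (FNeg q)).
Definition FOr p q := FImp (FNeg p) q.
Definition FIff p q := FAnd (FImp p q) (FImp q p).
Definition FEx p := FNeg (FAll (FNeg p)).

Declare Scope form_scope.
Delimit Scope form_scope with F.
Bind Scope form_scope with form.
Local Open Scope form_scope.

Notation "x ∈ y" := (FMem x y) (at level 70) : form_scope.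
Notation "x ≐ y" := (FEq x y) (at level 70) : form_scope.
Notation "¬ p" := (FNeg p) (at level 75, right associativity) : form_scope.
Notation "p ∧ q" := (FAnd p q) (at level 80, right associativity) : form_scope.
Notation "p ∨ q" := (FOr p q) (at level 85, right associativity) : form_scope.
Notation "p ⇒ q" := (FImp p q) (at level 90, right associativity) : form_scope.
Notation "p ⇔ q" := (FIff p q) (at level 95, no associativity) : form_scope.
Notation "∀ p" := (FAll p) (at level 99, p at level 99) : form_scope.
Notation "∃ p" := (FEx p) (at level 99, p at level 99) : form_scope.

(** Bounded quantifiers; [x] lives outside the binder. *)
Definition FAllIn (x : nat) p := ∀ (0 ∈ x.+1 ⇒ p).
Definition FExIn (x : nat) p := ∃ (0 ∈ x.+1 ∧ p).

Notation "'∀∈' x , p" := (FAllIn x p)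
  (at level 99, x at level 9, p at level 99) : form_scope.
Notation "'∃∈' x , p" := (FExIn x p)
  (at level 99, x at level 9, p at level 99) : form_scope.

Definition up (f : nat -> nat) (i : nat) := if i is j.+1 then (f j).+1 else 0.

Fixpoint rename (f : nat -> nat) (p : form) : form :=
  match p with
  | FMem x y => FMem (f x) (f y)
  | FEq x y => FEq (f x) (f y)
  | FBot => FBot
  | FImp p q => FImp (rename f p) (rename f q)
  | FAll p => FAll (rename (up f) p)
  end.

(** [p[[s, d]]] replaces the first [size s] variables of [p] by the members of
    [s]; the remaining ones (the parameters), renumbered from 0, are shifted
    by [d]. *)
Definition inst (s : seq nat) (d i : nat) :=
  if i < size s then nth 0 s i else d + (i - size s).

Notation "p '[[' s , d ']]'" := (rename (inst s d) p)
  (at level 2, left associativity) : form_scope.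

Inductive proves : (form -> Prop) -> form -> Prop :=
| Hyp (T : form -> Prop) p : T p -> proves T p
| ImpI T p q : proves (fun r => r = p \/ T r) q -> proves T (p ⇒ q)
| ImpE T p q : proves T (p ⇒ q) -> proves T p -> proves T q
| RAA T p : proves T (¬ ¬ p) -> proves T p
| AllI T p :
    proves (fun r => exists2 q, T q & r = rename S q) p -> proves T (∀ p)
| AllE T p x : proves T (∀ p) -> proves T p[[ [:: x], 0 ]]
| EqI T x : proves T (x ≐ x)
| EqE T p x y :
    proves T (x ≐ y) -> proves T p[[ [:: x], 0 ]] ->
    proves T p[[ [:: y], 0 ]].

Notation "T ⊢ p" := (proves T p) (at level 100, no associativity) : type_scope.

(** All free variables of [p] are smaller than [fv_bound p]. *)
Fixpoint fv_bound (p : form) : nat :=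
  match p with
  | FMem x y | FEq x y => maxn x.+1 y.+1
  | FBot => 0
  | FImp p q => maxn (fv_bound p) (fv_bound q)
  | FAll p => (fv_bound p).-1
  end.

Definition universal_closure (p : form) : form := iter (fv_bound p) FAll p.

(** Basic set-theoretic formulas; arguments are variables, and go up by one
    for every quantifier crossed. *)

Definition is_empty x := ∀ ¬ 0 ∈ x.+1.
Definition is_subset x y := ∀∈ x, 0 ∈ y.+1.
(* z = {x, y} *)
Definition is_upair z x y := ∀ (0 ∈ z.+1 ⇔ 0 ≐ x.+1 ∨ 0 ≐ y.+1).
(* y = x ∪ {x} *)
Definition is_succ y x := ∀ (0 ∈ y.+1 ⇔ 0 ∈ x.+1 ∨ 0 ≐ x.+1).
Definition is_inductive w :=
  (∃∈ w, is_empty 0) ∧ (∀∈ w, ∃∈ w.+1, is_succ 0 1).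

Definition ax_extensionality :=
  ∀ ∀ ((∀ (0 ∈ 2 ⇔ 0 ∈ 1)) ⇒ 1 ≐ 0).
Definition ax_pairing := ∀ ∀ ∃ is_upair 0 2 1.
Definition ax_union := ∀ ∃ ∀ (0 ∈ 1 ⇔ ∃∈ 2, 1 ∈ 0).
Definition ax_power := ∀ ∃ ∀ (0 ∈ 1 ⇔ is_subset 0 2).
Definition ax_infinity := ∃ is_inductive 0.
Definition ax_regularity := ∀ (¬ is_empty 0 ⇒ ∃∈ 0, ¬ ∃∈ 0, 0 ∈ 2).

(* p(x, parameters), with x the variable 0 *)
Definition ax_separation p :=
  universal_closure (∀ ∃ ∀ (0 ∈ 1 ⇔ 0 ∈ 2 ∧ p[[ [:: 0], 3 ]])).

(* p(x, y, parameters), with x the variable 0 and y the variable 1 *)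
Definition ax_replacement p :=
  universal_closure (
    (∀ ∀ ∀ (p[[ [:: 2; 1], 3 ]] ∧ p[[ [:: 2; 0], 3 ]] ⇒ 1 ≐ 0)) ⇒
    ∀ ∃ ∀ (0 ∈ 1 ⇔ ∃∈ 2, p[[ [:: 0; 1], 4 ]])).

Inductive ZF : form -> Prop :=
| ZF_extensionality : ZF ax_extensionality
| ZF_pairing : ZF ax_pairing
| ZF_union : ZF ax_union
| ZF_power : ZF ax_power
| ZF_infinity : ZF ax_infinity
| ZF_regularity : ZF ax_regularity
| ZF_separation p : ZF (ax_separation p)
| ZF_replacement p : ZF (ax_replacement p).

(* z = {{x}, {x, y}} *)
Definition is_opair z x y :=
  ∃ ∃ (is_upair 1 x.+2 x.+2 ∧ is_upair 0 x.+2 y.+2 ∧ is_upair z.+2 1 0).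
(* (x, y) ∈ f *)
Definition maps f x y := ∃∈ f, is_opair 0 x.+1 y.+1.
Definition is_function_on f A :=
  (∀∈ f, ∃∈ A.+1, ∃ is_opair 2 1 0) ∧
  (∀∈ A, ∃ (maps f.+2 1 0 ∧ ∀ (maps f.+3 2 0 ⇒ 0 ≐ 1))).
Definition is_function f A B :=
  is_function_on f A ∧ (∀ ∀ (maps f.+2 1 0 ⇒ 0 ∈ B.+2)).
Definition is_injection f A B :=
  is_function f A B ∧
  (∀ ∀ ∀ (maps f.+3 2 0 ∧ maps f.+3 1 0 ⇒ 2 ≐ 1)).
Definition is_bijection f A B :=
  is_injection f A B ∧ (∀∈ B, ∃ maps f.+2 0 1).
Definition equinumerous A B := ∃ is_bijection 0 A.+1 B.+1.

(** Cardinality.  Infinite means not equinumerous with a natural number, the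
    natural numbers being the members of every inductive set. *)

Definition is_natural x := ∀ (is_inductive 0 ⇒ x.+1 ∈ 0).
Definition is_infinite X := ¬ ∃ (is_natural 0 ∧ equinumerous X.+1 0).

(* x is the von Neumann numeral of n *)
Fixpoint is_numeral (n x : nat) : form :=
  if n is n'.+1 then ∃ (is_numeral n' 0 ∧ is_succ x.+1 0) else is_empty x.
(* |A| = n *)
Definition has_card (n A : nat) := ∃ (is_numeral n 0 ∧ equinumerous A.+1 0).
(* |A| ≤ n *)
Definition card_le (n A : nat) :=
  ∃ (is_numeral n 0 ∧ ∃ is_injection 0 A.+2 1).

(* s ∈ [X]^m *)
Definition in_subsets (m s X : nat) := is_subset s X ∧ has_card m s.

(* P = [X]^m *)
Definition is_subsets (m P X : nat) := ∀ (0 ∈ P.+1 ⇔ in_subsets m 0 X.+1).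

(* every fibre of the colouring h with values in C has at most n elements *)
Definition is_bounded (n h C : nat) :=
  ∀∈ C, ∃ ((∀ (0 ∈ 1 ⇔ maps h.+3 0 2)) ∧ card_le n 0).

Definition is_polychromatic (m h Z : nat) :=
  ∀ ∀ (in_subsets m 1 Z.+2 ∧ in_subsets m 0 Z.+2 ∧ ¬ 1 ≐ 0 ⇒
       ¬ ∃ (maps h.+3 2 0 ∧ maps h.+3 1 0)).

(* variables: X = 3, P = [X]^m = 2, C = 1, the colouring = 0 *)
Definition RRT (m n : nat) : form :=
  ∀ ∀ ∀ ∀
    (is_infinite 3 ∧ is_subsets m 2 3 ∧ is_infinite 1 ∧
       is_function 0 2 1 ∧ is_bounded n 0 1 ⇒
     ∃ (is_subset 0 4 ∧ is_infinite 0 ∧ is_polychromatic m 1 0)).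

Definition is_choice_function f B :=
  is_function_on f B ∧ (∀∈ B, ∀ (maps f.+2 1 0 ⇒ 0 ∈ 1)).

Definition AC_minus (n : nat) : form :=
  ∀ (is_infinite 0 ∧ (∀∈ 0, has_card n 0) ⇒
     ∃ (is_subset 0 1 ∧ is_infinite 0 ∧ ∃ is_choice_function 0 1)).

(* Main.v *)
Require Import Defs.
From mathcomp Require Import all_boot.
From mathcomp Require Import boolp.

(** By the completeness theorem it is enough to argue in an arbitrary model of
    ZF, where a set of standard finite cardinality is the same as a set whose
    members are listed by a duplicate-free sequence of that length, so that
    finite combinatorics can be done outside the model.

    Let [A] be an infinite family of [n]-element sets and let [X] be the
    disjoint union of its members (the fibres).  An equivalence relation on
    [[X]^m] with classes of at most [r] elements is an [r]-bounded colouring,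
    so there is an infinite [Y] such that no two distinct [m]-subsets of [Y]
    are equivalent.  In (1) the relation identifies [s] with the set obtained
    by exchanging the two points of every fibre.  In (2), (3) and (4), where
    [m = 2b - j], it identifies any two sets that consist of [j] single points
    and [b - j] pairs taken from the same [b] fibres; a class then has
    ['C(b, j) * n ^ j * 'C(n, 2) ^ (b - j)] elements, with [b = k + 1] and
    [j = 1] in (2), [b = k + 1] and [j = 2] in (3), [b = 1] and [j = 0] in (4).
    In (1) to (3), only finitely many fibres meet [Y] in two points or more:
    otherwise one could exchange, in (1), or replace, in (2) and (3), single
    points of some [s] without leaving [Y].  Hence infinitely many fibres meet
    [Y] in exactly one point, which is chosen.
    In (4), no fibre is contained in [Y]; the chosen point is the only one in
    [Y] or the only one outside [Y]. *)

Set Implicit Arguments.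
Unset Strict Implicit.
Unset Printing Implicit Defensive.

(** * Counting fibre systems *)

Lemma sum_card_fibres (I J : finType) (D : {set I * J}) :
  #|D| = \sum_i #|[set q | (i, q) \in D]|.
Proof.
rewrite -sum1_card (reindex (fun p : I * J => (p.1, p.2))) /=; last first.
  by exists id => -[].
under [RHS]eq_bigr => i _ do rewrite -sum1_card.
rewrite pair_big_dep /=; apply: eq_bigl => -[i q] /=.
by rewrite inE.
Qed.

(** Each [F i] has one or two elements, so adding 1 for every singleton to the total [m] gives [2b]:
    exactly [j] of the [F i] are singletons. Their places can be chosen in ['C(b, j)] ways, then
    each singleton in [n] ways and each pair in ['C(n, 2)] ways. *)
Lemma card_fibre_systems (b n j m : nat) : m + j = b.*2 ->
  #|[set F : {ffun 'I_b -> {set 'I_n}} |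
      [forall i, 0 < #|F i| <= 2] && (\sum_i #|F i| == m)]|
  <= 'C(b, j) * n ^ j * 'C(n, 2) ^ (b - j).
Proof.
move=> mj; pose J (F : {ffun 'I_b -> {set 'I_n}}) := [set i | #|F i| == 1].
rewrite -sum1_card (partition_big J (fun K : {set 'I_b} => #|K| == j)) /=; last first.
  move=> F; rewrite inE => /andP[/forallP F12 /eqP sumF].
  rewrite -(eqn_add2l m) mj -sumF -sum1dep_card [X in _ + X]big_mkcond -big_split /=.
  rewrite (eq_bigr (fun=> 2)) ?sum_nat_const ?card_ord ?muln2 // => i _.
  by have := F12 i; case: #|F i| => [|[|[|] ] ].
apply: (@leq_trans (\sum_(K : {set 'I_b} | #|K| == j) n ^ j * 'C(n, 2) ^ (b - j))).
  apply: leq_sum => K /eqP cK.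
  pose fam i := [set A : {set 'I_n} | #|A| == if i \in K then 1 else 2].
  apply: (@leq_trans #|family (fun i => mem (fam i))|).
    rewrite sum1_card; apply: subset_leq_card; apply/subsetP => F.
    rewrite unfold_in inE => /andP[/andP[/forallP F12 _] /eqP JK]; apply/familyP => i.
    by rewrite /= inE -JK inE; have := F12 i; case: #|F i| => [|[|[|] ] ].
  rewrite card_family foldrE big_map big_enum /=.
  rewrite (bigID (mem K)) /= (eq_bigr (fun=> n)); last first.
    by move=> i iK; rewrite /fam iK card_draws card_ord bin1.
  rewrite [X in _ * X](eq_bigr (fun=> 'C(n, 2))); last first.
    by move=> i /negPf iK; rewrite /fam iK card_draws card_ord.
  rewrite !prod_nat_const cK.
  have -> : #|[pred i | i \notin K]| = b - j.
    have /(congr1 (subn^~ j)) := cardC (mem K).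
    by rewrite cK card_ord addKn => <-; apply: eq_card.
  by rewrite leqnn.
rewrite sum_nat_const -mulnA leq_mul2r.
by rewrite -(card_ord b) -card_draws card_ord cardsE leqnn orbT.
Qed.

(** * Completeness *)

Lemma rename_ext f g p :
  (forall i, i < fv_bound p -> f i = g i) -> rename f p = rename g p.
Proof.
elim: p f g => [x y|x y||p IHp q IHq|p IHp] f g fg //=.
- by rewrite !fg //= leq_max leqnn ?orbT.
- by rewrite !fg //= leq_max leqnn ?orbT.
- by congr FImp; [apply: IHp | apply: IHq] => i lti; apply: fg;
    rewrite /= leq_max lti ?orbT.
- congr FAll; apply: IHp => -[//|i] lti /=; congr S; apply: fg => /=.
  by rewrite ltn_predRL.
Qed.

Lemma rename_comp f g p : rename f (rename g p) = rename (f \o g) p.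
Proof.
elim: p f g => [x y|x y||p IHp q IHq|p IHp] f g //=; first by rewrite IHp IHq.
by rewrite IHp; congr FAll; apply: rename_ext => -[|i].
Qed.

Lemma rename_id p : rename id p = p.
Proof.
elim: p => //= [p -> q -> //|p IHp].
by rewrite -[in RHS]IHp; congr FAll; apply: rename_ext => -[|i].
Qed.

Lemma fv_bound_rename f p K :
  (forall i, i < fv_bound p -> f i < K) -> fv_bound (rename f p) <= K.
Proof.
elim: p f K => [x y|x y||p IHp q IHq|p IHp] f K fK //=.
- by rewrite geq_max !fK //= leq_max leqnn ?orbT.
- by rewrite geq_max !fK //= leq_max leqnn ?orbT.
- by rewrite geq_max; apply/andP; split; [apply: IHp | apply: IHq] => i lti;
    apply: fK; rewrite /= leq_max lti ?orbT.
- rewrite -[K]/(K.+1.-1) -!subn1 leq_sub2r //; apply: IHp => -[//|i] lti /=.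
  by rewrite ltnS; apply: fK; rewrite /= ltn_predRL.
Qed.

Lemma inst1_0 x : inst [:: x] 0 0 = x.
Proof. by []. Qed.

Lemma inst1_S x i : inst [:: x] 0 i.+1 = i.
Proof. by rewrite /inst /= subn1. Qed.

Lemma rename_inst1 f x p :
  rename f p[[ [:: x], 0 ]] = (rename (up f) p)[[ [:: f x], 0 ]].
Proof.
rewrite !rename_comp; apply: rename_ext => -[|i] _ //=.
by rewrite !inst1_S.
Qed.

(** * Admissible rules of the calculus *)

Lemma proves_weaken T T' p : (forall q, T q -> T' q) -> (T ⊢ p) -> (T' ⊢ p).
Proof.
move=> TT' pr; elim: pr T' TT' => {T p}.
- by move=> T p Tp T' TT'; apply: Hyp; apply: TT'.
- move=> T p q _ IH T' TT'; apply: ImpI; apply: IH => r [->|/TT']; first by left.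
  by right.
- by move=> T p q _ IH1 _ IH2 T' TT'; apply: ImpE (IH1 _ TT') (IH2 _ TT').
- by move=> T p _ IH T' TT'; apply: RAA (IH _ TT').
- move=> T p _ IH T' TT'; apply: AllI; apply: IH => _ [q Tq ->].
  by exists q => //; apply: TT'.
- by move=> T p x _ IH T' TT'; apply: AllE (IH _ TT').
- by move=> T x T' _; apply: EqI.
- by move=> T p x y _ IH1 _ IH2 T' TT'; apply: EqE (IH1 _ TT') (IH2 _ TT').
Qed.

Lemma proves_rename f T p :
  (T ⊢ p) -> ((fun r => exists2 q, T q & r = rename f q) ⊢ rename f p).
Proof.
move=> pr; elim: pr f => {T p}.
- by move=> T p Tp f; apply: Hyp; exists p.
- move=> T p q _ IH f /=; apply: ImpI; apply: proves_weaken (IH f).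
  by move=> r [s [->|Ts] ->]; [left | right; exists s].
- by move=> T p q _ IH1 _ IH2 f; apply: ImpE (IH1 f) (IH2 f).
- by move=> T p _ IH f; apply: RAA (IH f).
- move=> T p _ IH f /=; apply: AllI; apply: proves_weaken (IH (up f)).
  move=> r [_ [s Ts ->] ->]; exists (rename f s); first by exists s.
  by rewrite !rename_comp.
- by move=> T p x _ IH f; rewrite rename_inst1; apply: AllE (IH f).
- by move=> T x f; apply: EqI.
- move=> T p x y _ IH1 _ IH2 f; rewrite rename_inst1.
  apply: (EqE (x := f x)); first exact: IH1.
  by rewrite -rename_inst1.
Qed.

(** Since [x] is fresh, renaming it to 0 and shifting all other variables turns the derivation of
    the instance into one of [p] from the shifted hypotheses, as [AllI] requires. *)
Lemma generalization T p x :
  (forall q, T q -> fv_bound q <= x) -> fv_bound p <= x ->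
  (T ⊢ p[[ [:: x], 0 ]]) -> (T ⊢ (∀ p)%F).
Proof.
move=> Tx px pr; apply: AllI.
pose f i := if i == x then 0 else i.+1.
have fS q : fv_bound q <= x -> rename f q = rename S q.
  move=> qx; apply: rename_ext => i lti.
  by rewrite /f ltn_eqF // (leq_trans lti).
have -> : p = rename f p[[ [:: x], 0 ]].
  rewrite rename_comp -[LHS]rename_id; apply: rename_ext => -[|i] lti /=.
    by rewrite /f eqxx.
  by rewrite inst1_S /f ltn_eqF // (leq_trans (ltnW lti)).
apply: proves_weaken (proves_rename f pr) => r [q Tq ->].
by exists q => //; rewrite fS //; apply: Tx.
Qed.

(** A derivation uses finitely many hypotheses. The chain [U] is generalized in the induction
    because [ImpI] and [AllI] change the theory. *)
Lemma proves_chain T p (U : nat -> form -> Prop) :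
  (T ⊢ p) -> (forall n q, U n q -> U n.+1 q) ->
  (forall q, T q -> exists n, U n q) -> exists n, U n ⊢ p.
Proof.
have mono (V : nat -> form -> Prop) : (forall n q, V n q -> V n.+1 q) ->
    forall m n q, m <= n -> V m q -> V n q.
  move=> VS m n q /subnK <-; elim: (n - m) => //= d IH /IH.
  by rewrite addSn; apply: VS.
move=> pr; elim: pr U => {T p}.
- by move=> T p Tp U US TU; have [n Un] := TU p Tp; exists n; apply: Hyp.
- move=> T p q _ IH U US TU.
  have [||n pr] := IH (fun n r => r = p \/ U n r).
  + by move=> n r [->|/US]; [left | right].
  + by move=> r [->|/TU[n Un] ]; [exists 0; left | exists n; right].
  by exists n; apply: ImpI.
- move=> T p q _ IH1 _ IH2 U US TU.
  have [n1 pr1] := IH1 U US TU; have [n2 pr2] := IH2 U US TU.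
  exists (maxn n1 n2).
  apply: ImpE (proves_weaken _ pr1) (proves_weaken _ pr2) => q';
    by apply: mono => //; rewrite leq_max leqnn ?orbT.
- by move=> T p _ IH U US TU; have [n pr] := IH U US TU; exists n; apply: RAA.
- move=> T p _ IH U US TU.
  have [||n pr] := IH (fun n r => exists2 q, U n q & r = rename S q).
  + by move=> n r [q /US Uq ->]; exists q.
  + by move=> r [q /TU[n Un] ->]; exists n, q.
  by exists n; apply: AllI.
- by move=> T p x _ IH U US TU; have [n pr] := IH U US TU; exists n; apply: AllE.
- by move=> T x U _ _; exists 0; apply: EqI.
- move=> T p x y _ IH1 _ IH2 U US TU.
  have [n1 pr1] := IH1 U US TU; have [n2 pr2] := IH2 U US TU.
  exists (maxn n1 n2).
  apply: EqE (proves_weaken _ pr1) (proves_weaken _ pr2) => q';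
    by apply: mono => //; rewrite leq_max leqnn ?orbT.
Qed.

(** * Consistency and an enumeration of formulas *)

Definition add (T : form -> Prop) p : form -> Prop := fun r => r = p \/ T r.
Definition consistent T := ~ (T ⊢ FBot).

Lemma add_weaken T p q : (T ⊢ q) -> (add T p ⊢ q).
Proof. by apply: proves_weaken => r; right. Qed.

Lemma proves_negI T p : ~ consistent (add T p) -> T ⊢ (¬ p)%F.
Proof. by move/contrapT => pr; apply: ImpI. Qed.

Lemma proves_dneg T p : ~ consistent (add T (¬ p)%F) -> T ⊢ p.
Proof. by move/proves_negI; apply: RAA. Qed.

Lemma proves_exfalso T p : (T ⊢ FBot) -> (T ⊢ p).
Proof. by move=> pr; apply: RAA; apply: ImpI; apply: add_weaken. Qed.

Fixpoint form_tree (p : form) : GenTree.tree nat :=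
  match p with
  | FMem x y => GenTree.Node 0 [:: GenTree.Leaf x; GenTree.Leaf y]
  | FEq x y => GenTree.Node 1 [:: GenTree.Leaf x; GenTree.Leaf y]
  | FBot => GenTree.Node 2 [::]
  | FImp p q => GenTree.Node 3 [:: form_tree p; form_tree q]
  | FAll p => GenTree.Node 4 [:: form_tree p]
  end.

Fixpoint tree_form (t : GenTree.tree nat) : form :=
  match t with
  | GenTree.Node 0 [:: GenTree.Leaf x; GenTree.Leaf y] => FMem x y
  | GenTree.Node 1 [:: GenTree.Leaf x; GenTree.Leaf y] => FEq x y
  | GenTree.Node 3 [:: t; u] => FImp (tree_form t) (tree_form u)
  | GenTree.Node 4 [:: t] => FAll (tree_form t)
  | _ => FBot
  end.

Lemma form_treeK : cancel form_tree tree_form.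
Proof. by elim=> //= [p -> q ->|p ->]. Qed.

Definition nth_form n : form := oapp tree_form FBot (unpickle n).

Lemma nth_form_surj p : exists n, nth_form n = p.
Proof.
by exists (pickle (form_tree p)); rewrite /nth_form pickleK /= form_treeK.
Qed.

(** * Tarski semantics *)

Definition scons M (d : M) (rho : nat -> M) i := if i is j.+1 then rho j else d.

Fixpoint sat M (E : M -> M -> Prop) (rho : nat -> M) (p : form) : Prop :=
  match p with
  | FMem x y => E (rho x) (rho y)
  | FEq x y => rho x = rho y
  | FBot => False
  | FImp p q => sat E rho p -> sat E rho q
  | FAll p => forall d, sat E (scons d rho) p
  end.

Lemma sat_ext M (E : M -> M -> Prop) rho sigma p :
  (forall i, i < fv_bound p -> rho i = sigma i) ->
  sat E rho p <-> sat E sigma p.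
Proof.
elim: p rho sigma => [x y|x y||p IHp q IHq|p IHp] rho sigma eq_rs //=.
- by rewrite !eq_rs //= leq_max leqnn ?orbT.
- by rewrite !eq_rs //= leq_max leqnn ?orbT.
- rewrite (IHp _ sigma) 1?(IHq _ sigma) // => i lti; apply: eq_rs;
    by rewrite /= leq_max lti ?orbT.
- have IH d : sat E (scons d rho) p <-> sat E (scons d sigma) p.
    by apply: IHp => -[//|i] lti; apply: eq_rs => /=; rewrite ltn_predRL.
  by split=> H d; apply/IH.
Qed.

Lemma sat_rename M (E : M -> M -> Prop) f rho p :
  sat E rho (rename f p) <-> sat E (rho \o f) p.
Proof.
elim: p f rho => [x y|x y||p IHp q IHq|p IHp] f rho //=.
  by rewrite IHp IHq.
have IH d : sat E (scons d rho) (rename (up f) p) <-> sat E (scons d (rho \o f)) p.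
  by rewrite IHp; apply: sat_ext => -[|i].
by split=> H d; apply/IH.
Qed.

(** * The Henkin construction and the term model *)

Section Henkin.
Variables (T : form -> Prop) (N0 : nat).
Hypothesis T_bound : forall q, T q -> fv_bound q <= N0.
Hypothesis T_cons : consistent T.

Fixpoint bound n :=
  if n is n'.+1 then (maxn (bound n') (fv_bound (nth_form n'))).+1 else N0.

(* The Henkin constants are variables; this one is fresh for [stage n] and for
   [nth_form n]. *)
Definition witness n := maxn (bound n) (fv_bound (nth_form n)).

(** The dual of the usual Henkin axiom, as [∀] is the primitive quantifier: the witness is a
    counterexample to [nth_form n] if there is one. *)
Definition henkin_axiom n :=
  ((nth_form n)[[ [:: witness n], 0 ]] ⇒ ∀ nth_form n)%F.

Fixpoint stage n : form -> Prop :=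
  if n is n'.+1 then
    let U := add (stage n') (henkin_axiom n') in
    fun q => U q \/ (q = nth_form n' /\ consistent (add U q))
  else T.

Lemma stageS n q : stage n q -> stage n.+1 q.
Proof. by left; right. Qed.

Lemma stage_bound n q : stage n q -> fv_bound q <= bound n.
Proof.
elim: n q => [|n IH] q /=; first exact: T_bound.
have le_w : fv_bound (nth_form n) <= witness n by rewrite leq_maxr.
case=> [ [->|/IH le_q]|[-> _] ]; last exact: leqW.
  rewrite /henkin_axiom /= geq_max; apply/andP; split.
    apply: fv_bound_rename => -[_|i lti]; first by rewrite inst1_0.
    by rewrite inst1_S ltnS (leq_trans (ltnW (ltnW lti))).
  by apply: (leq_trans (leq_pred _)); apply: leqW.
by apply: leqW; rewrite (leq_trans le_q) // leq_maxl.
Qed.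

(** If the axiom were refutable, its premise would be provable and its conclusion refutable. But the
    witness is fresh, so the premise generalizes to the conclusion. *)
Lemma henkin_consistent n :
  consistent (stage n) -> consistent (add (stage n) (henkin_axiom n)).
Proof.
move=> cons_n pr; apply: (cons_n).
set p := (nth_form n)[[ [:: witness n], 0 ]].
have neg : stage n ⊢ (¬ henkin_axiom n)%F by apply: ImpI.
have prp : stage n ⊢ p.
  apply: proves_dneg; apply=> //.
  apply: ImpE (add_weaken _ neg) _; apply: ImpI; apply: proves_exfalso.
  by apply: (ImpE (p := p)); apply: Hyp; [right; left | left].
apply: ImpE neg _; apply: ImpI; apply: add_weaken; apply: generalization prp.
  by move=> q /stage_bound /leq_trans; apply; rewrite leq_maxl.
by rewrite leq_maxr.
Qed.

Lemma stage_consistent n : consistent (stage n).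
Proof.
elim: n => [//|n /henkin_consistent consU] /=.
case: (pselect (consistent (add (add (stage n) (henkin_axiom n)) (nth_form n)))).
  move=> cons; apply: contra_not cons; apply: proves_weaken => q.
  by case=> [|[-> _] ]; [right | left].
move=> ncons pr; apply: consU; apply: proves_weaken pr => q [//|[-> cons] ].
by case: ncons.
Qed.

Definition limit p := exists n, stage n p.

Definition thm p := limit ⊢ p.

Lemma thm_T p : T p -> thm p.
Proof. by move=> Tp; apply: Hyp; exists 0. Qed.

Lemma thm_bot : ~ thm FBot.
Proof.
move=> pr; have [||n] := proves_chain (U := stage) pr.
- by move=> n q; apply: stageS.
- by [].
exact: stage_consistent.
Qed.

(** Every formula is some [nth_form n], and it enters [stage n.+1] unless it is inconsistent with
    the axioms collected so far, which then refute it. *)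
Lemma thm_neg p : ~ thm p -> thm (¬ p)%F.
Proof.
have [n <-] := nth_form_surj p => npr.
set U := add (stage n) (henkin_axiom n).
have UL q : U q -> limit q by move=> Uq; exists n.+1; left.
apply: proves_weaken UL _; apply: proves_negI => cons.
by apply: npr; apply: Hyp; exists n.+1; right.
Qed.

Lemma thm_imp p q : thm (p ⇒ q)%F <-> (thm p -> thm q).
Proof.
split=> [prpq prp|H]; first exact: ImpE prpq prp.
have [/H prq|/thm_neg prnp] := pselect (thm p).
  by apply: ImpI; apply: add_weaken.
apply: ImpI; apply: proves_exfalso; apply: ImpE (add_weaken _ prnp) _.
by apply: Hyp; left.
Qed.

Lemma thm_all p : thm (∀ p)%F <-> forall x, thm p[[ [:: x], 0 ]].
Proof.
split=> [prp x|H]; first exact: AllE.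
have [n def_p] := nth_form_surj p.
rewrite -def_p; apply: ImpE (H (witness n)).
by rewrite -def_p; apply: Hyp; exists n.+1; left; left.
Qed.

Lemma thm_eq_refl x : thm (x ≐ x)%F.
Proof. exact: EqI. Qed.

Lemma thm_eq_sym x y : thm (x ≐ y)%F -> thm (y ≐ x)%F.
Proof.
move=> xy; have := @EqE _ (0 ≐ x.+1)%F _ _ xy.
by rewrite /= !inst1_S; apply; apply: EqI.
Qed.

Lemma thm_eq_trans x y z : thm (x ≐ y)%F -> thm (y ≐ z)%F -> thm (x ≐ z)%F.
Proof.
move=> xy yz; have := @EqE _ (x.+1 ≐ 0)%F _ _ yz.
by rewrite /= !inst1_S; apply.
Qed.

Lemma thm_mem_cong x x' y y' : thm (x ≐ x')%F -> thm (y ≐ y')%F ->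
  thm (x ∈ y)%F -> thm (x' ∈ y')%F.
Proof.
move=> xx' yy' xy; have := @EqE _ (0 ∈ y.+1)%F _ _ xx'.
rewrite /= !inst1_S => /(_ xy) x'y; have := @EqE _ (x'.+1 ∈ 0)%F _ _ yy'.
by rewrite /= !inst1_S; apply.
Qed.

Lemma thm_eq_ex x : exists y, `[< thm (x ≐ y)%F >].
Proof. by exists x; apply/asboolP/thm_eq_refl. Qed.

(** Classes of provably equal variables are represented by their least member. The term model is
    thus a subtype of [nat], hence countable, and [≐] is interpreted by true equality. *)
Definition canon x := ex_minn (thm_eq_ex x).

Lemma thm_canon x : thm (x ≐ canon x)%F.
Proof. by rewrite /canon; case: ex_minnP => y /asboolP. Qed.

Lemma canon_eq x y : canon x = canon y <-> thm (x ≐ y)%F.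
Proof.
split=> [eq_c|xy].
  apply: thm_eq_trans (thm_canon x) _; rewrite eq_c.
  exact/thm_eq_sym/thm_canon.
have same z : `[< thm (x ≐ z)%F >] = `[< thm (y ≐ z)%F >].
  apply: asbool_equiv_eq; split; apply: thm_eq_trans => //.
  exact: thm_eq_sym.
rewrite /canon; case: ex_minnP => u pu minu; case: ex_minnP => v pv minv.
by apply/eqP; rewrite eqn_leq minu ?minv // ?same // -same.
Qed.

Definition term_model := {x : nat | canon x == x}.

Lemma canonK x : canon (canon x) == canon x.
Proof. by apply/eqP; apply/canon_eq/thm_eq_sym/thm_canon. Qed.

Definition cls x : term_model := exist _ (canon x) (canonK x).

Definition mem_model (a b : term_model) := thm (val a ∈ val b)%F.

Lemma cls_val (a : term_model) : cls (val a) = a.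
Proof. by apply: val_inj; apply/eqP; case: a. Qed.

(** The truth lemma. It is stated for an arbitrary renaming [f] because in the quantifier case an
    element of the model enters as a variable substituted for the bound one. *)
Lemma sat_thm f p : sat mem_model (cls \o f) p <-> thm (rename f p).
Proof.
elim: p f => [x y|x y||p IHp q IHq|p IHp] f /=.
- rewrite /mem_model /=; split; apply: thm_mem_cong; try exact: thm_canon.
  + exact/thm_eq_sym/thm_canon.
  + exact/thm_eq_sym/thm_canon.
- by rewrite -canon_eq; split=> [ []|eq_c] //; apply: val_inj.
- by split=> // /thm_bot.
- by rewrite IHp IHq thm_imp.
- rewrite thm_all; split=> H.
    move=> x; rewrite rename_comp; apply/IHp.
    apply: (iffLR (sat_ext _ _)) (H (cls x)) => -[|i] _ //=.
    by rewrite inst1_S.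
  move=> d; have := H (val d); rewrite rename_comp => /IHp.
  apply: (iffLR (sat_ext _ _)) => -[|i] _ //=; first by rewrite cls_val.
  by rewrite inst1_S.
Qed.

End Henkin.

(** If [T] with [¬ p] were consistent, its term model would satisfy both when each variable denotes
    its class. The members of [T] are closed, so they would hold under every assignment, and
    validity would give [p]. *)
Theorem completeness (T : form -> Prop) p :
  (forall q, T q -> fv_bound q = 0) ->
  (forall (M : countType) (E : M -> M -> Prop),
     (forall q rho, T q -> sat E rho q) -> forall rho, sat E rho p) ->
  T ⊢ p.
Proof.
move=> closedT valid; apply: proves_dneg => cons.
have bd q : add T (¬ p)%F q -> fv_bound q <= fv_bound p.
  by case=> [->|/closedT ->//]; rewrite /= maxn0.
pose E := @mem_model (add T (¬ p)%F) (fv_bound p).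
pose c := cls (add T (¬ p)%F) (fv_bound p).
have satT q : add T (¬ p)%F q -> sat E c q.
  move=> Tq; apply/(sat_thm bd cons id); rewrite rename_id.
  exact: thm_T.
have: sat E c (¬ p)%F by apply: satT; left.
apply; apply: valid => q rho Tq.
have := satT q (or_intror Tq); apply: (iffLR (sat_ext _ _)) => i.
by rewrite closedT.
Qed.

(** * Definability in models of ZF *)

Lemma fv_bound_closure p : fv_bound (universal_closure p) = 0.
Proof.
rewrite /universal_closure; apply/eqP; rewrite -leqn0 -(subnn (fv_bound p)).
by elim: {1 3}(fv_bound p) => [|n IH]; rewrite ?subn0 //= subnS -!subn1 leq_sub2r.
Qed.

Lemma ZF_closed p : ZF p -> fv_bound p = 0.
Proof. by case=> // q; apply: fv_bound_closure. Qed.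

Section Definability.
Variables (M : countType) (E : M -> M -> Prop).
Local Notation sat := (sat E).
Implicit Types (rho : nat -> M) (p q : form).

Lemma sat_closure p :
  (forall rho, sat rho (universal_closure p)) -> forall rho, sat rho p.
Proof.
rewrite /universal_closure; elim: (fv_bound p) => //= n IH H.
apply: IH => rho; apply: (iffLR (sat_ext _ _)) (H (rho \o S) (rho 0)).
by case.
Qed.

(** This relation lets a formula be translated connective by connective into an ordinary
    proposition; the defined connectives need classical logic. *)
Definition denotes rho p (P : Prop) := sat rho p <-> P.

Lemma denotes_and rho p q P Q :
  denotes rho p P -> denotes rho q Q -> denotes rho (p ∧ q)%F (P /\ Q).
Proof.
rewrite /denotes /= => <- <-; split=> [H|[hp hq] ]; last by apply.
by split; apply: contrapT => n; apply: H => hp hq; apply: n.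
Qed.

Lemma denotes_imp rho p q P Q :
  denotes rho p P -> denotes rho q Q -> denotes rho (p ⇒ q)%F (P -> Q).
Proof. by rewrite /denotes /= => -> ->. Qed.

Lemma denotes_neg rho p P :
  denotes rho p P -> denotes rho (¬ p)%F (~ P).
Proof. by rewrite /denotes /= => ->. Qed.

Lemma denotes_or rho p q P Q :
  denotes rho p P -> denotes rho q Q -> denotes rho (p ∨ q)%F (P \/ Q).
Proof.
rewrite /denotes /= => <- <-; split=> [H|[hp //|//] ].
by have [hp|hp] := pselect (sat rho p); [left | right; apply: H].
Qed.

Lemma denotes_iff rho p q P Q :
  denotes rho p P -> denotes rho q Q -> denotes rho (p ⇔ q)%F (P <-> Q).
Proof. by move=> dP dQ; apply: denotes_and; apply: denotes_imp. Qed.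

Lemma denotes_all rho p P :
  (forall d, denotes (scons d rho) p (P d)) ->
  denotes rho (∀ p)%F (forall d, P d).
Proof. by move=> H; split=> /= h d; apply/H. Qed.

Lemma denotes_ex rho p P :
  (forall d, denotes (scons d rho) p (P d)) ->
  denotes rho (∃ p)%F (exists d, P d).
Proof.
move=> H; rewrite /denotes /=; split=> [h|[d /H hd] ]; last by move/(_ d); apply.
by apply: contrapT => n; apply: h => d hd; apply: n; exists d; apply/H.
Qed.

Definition lookup rho (s : nat + M) := match s with inl i => rho i | inr c => c end.

(* Definability with parameters: [e] says which variables of the formula stand
   for which of the arguments [rho], and which ones for parameters. *)
Definition definable (P : (nat -> M) -> Prop) :=
  exists p (e : nat -> nat + M),
    forall rho, P rho <-> sat (fun i => lookup rho (e i)) p.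

Definition definable_term (t : (nat -> M) -> M) :=
  definable (fun rho => rho 0 = t (fun i => rho i.+1)).

Lemma definable_equiv P Q :
  (forall rho, P rho <-> Q rho) -> definable P -> definable Q.
Proof. by move=> PQ [p [e pe] ]; exists p, e => rho; rewrite -PQ. Qed.

Lemma definable_const (P : Prop) : definable (fun=> P).
Proof.
have [hP|nP] := pselect P.
  by exists (FBot ⇒ FBot)%F, inl => rho; split=> // _ /=.
by exists FBot, inl => rho; split.
Qed.

Lemma definable_sub P (s : nat -> nat + M) :
  definable P -> definable (fun rho => P (fun i => lookup rho (s i))).
Proof.
move=> [p [e pe] ].
exists p, (fun i => match e i with inl j => s j | inr c => inr c end) => rho.
rewrite pe; apply: sat_ext => i _.
by case: (e i).
Qed.

(** The two formulas come with different readings of their variables, so even variables are reserved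
    for [p] and odd ones for [q]. *)
Lemma definable_imp P Q :
  definable P -> definable Q -> definable (fun rho => P rho -> Q rho).
Proof.
move=> [p [e pe] ] [q [f qf] ].
exists (rename double p ⇒ rename (fun i => i.*2.+1) q)%F.
exists (fun i => if odd i then f i./2 else e i./2) => rho /=.
rewrite pe qf !sat_rename.
have -> : sat ((fun i => lookup rho (if odd i then f i./2 else e i./2)) \o double) p
  <-> sat (fun i => lookup rho (e i)) p.
  by apply: sat_ext => i _ /=; rewrite odd_double doubleK.
have -> : sat ((fun i => lookup rho (if odd i then f i./2 else e i./2)) \o
     (fun i => i.*2.+1)) q <-> sat (fun i => lookup rho (f i)) q.
  by apply: sat_ext => i _ /=; rewrite odd_double /= uphalf_double.
by [].
Qed.

Lemma definable_not P : definable P -> definable (fun rho => ~ P rho).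
Proof. by move=> dP; apply: definable_imp => //; apply: definable_const. Qed.

Lemma definable_and P Q :
  definable P -> definable Q -> definable (fun rho => P rho /\ Q rho).
Proof.
move=> dP dQ; apply: (@definable_equiv (fun rho => ~ (P rho -> ~ Q rho))).
  move=> rho; split=> [H|[hP hQ] ]; last by apply.
  by split; apply: contrapT => n; apply: H.
by apply: definable_not; apply: definable_imp => //; apply: definable_not.
Qed.

Lemma definable_or P Q :
  definable P -> definable Q -> definable (fun rho => P rho \/ Q rho).
Proof.
move=> dP dQ; apply: (@definable_equiv (fun rho => ~ P rho -> Q rho)).
  move=> rho; split=> [H|[hP //|//] ].
  by have [hp|hp] := pselect (P rho); [left | right; apply: H].
by apply: definable_imp => //; apply: definable_not.
Qed.

Lemma definable_iff P Q :
  definable P -> definable Q -> definable (fun rho => P rho <-> Q rho).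
Proof. by move=> dP dQ; apply: definable_and; apply: definable_imp. Qed.

Lemma definable_all (P : (nat -> M) -> M -> Prop) :
  definable (fun rho => P (fun i => rho i.+1) (rho 0)) ->
  definable (fun rho => forall x, P rho x).
Proof.
move=> [p [e pe] ].
(* Several variables of [p] may stand for argument 0; all of them become the bound variable. The
   other arguments move down by one, hence [j.-1]. *)
pose is0 i := if e i is inl 0 then true else false.
exists (∀ rename (fun i => if is0 i then 0 else i.+1) p)%F.
exists (fun i => match e i with inl j => inl j.-1 | inr c => inr c end) => rho.
split=> H x; last move: (H x).
  apply/sat_rename; move/(pe (scons x rho)): (H x).
  apply: (iffLR (sat_ext _ _)) => i _ /=; rewrite /is0.
  by case e_i: (e i) => [ [|j]|c] //=; rewrite e_i.
move/sat_rename => Hx; apply/(pe (scons x rho)); move: Hx.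
apply: (iffLR (sat_ext _ _)) => i _ /=; rewrite /is0.
by case e_i: (e i) => [ [|j]|c] //=; rewrite e_i.
Qed.

Lemma definable_ex (P : (nat -> M) -> M -> Prop) :
  definable (fun rho => P (fun i => rho i.+1) (rho 0)) ->
  definable (fun rho => exists x, P rho x).
Proof.
move=> dP; apply: (@definable_equiv (fun rho => ~ forall x, ~ P rho x)).
  move=> rho; split=> [H|[x hx] ]; last by move/(_ x); apply.
  by apply: contrapT => n; apply: H => x hx; apply: n; exists x.
by apply/definable_not/definable_all/definable_not.
Qed.

Lemma definable_var i : definable_term (fun rho => rho i).
Proof. by exists (0 ≐ i.+1)%F, inl. Qed.

Lemma definable_param c : definable_term (fun=> c).
Proof. by exists (0 ≐ 1)%F, (fun i => if i is 0 then inl 0 else inr c). Qed.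

(** Terms are definable only through their graphs, so their values are introduced by quantifiers and
    equations. *)
Lemma definable_app2 (P : M -> M -> Prop) t u :
  definable (fun rho => P (rho 0) (rho 1)) ->
  definable_term t -> definable_term u ->
  definable (fun rho => P (t rho) (u rho)).
Proof.
move=> dP dt du.
apply: (@definable_equiv
  (fun rho => forall a b, a = t rho -> b = u rho -> P a b)).
  by move=> rho; split=> [|H a b -> ->] //; apply.
apply: definable_all; apply: definable_all; apply: definable_imp.
  exact: (definable_sub (fun i => inl i.+1) dt).
apply: definable_imp.
  exact: (definable_sub (fun i => inl (if i is j.+1 then j.+2 else 0)) du).
exact: (definable_sub (fun i => inl (if i is 0 then 1 else 0)) dP).
Qed.

Lemma definable_mem t u : definable_term t -> definable_term u ->
  definable (fun rho => E (t rho) (u rho)).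
Proof. by apply: definable_app2; exists (0 ∈ 1)%F, inl. Qed.

Lemma definable_eq t u : definable_term t -> definable_term u ->
  definable (fun rho => t rho = u rho).
Proof. by apply: definable_app2; exists (0 ≐ 1)%F, inl. Qed.

Lemma definable_term2 (F : M -> M -> M) t u :
  definable (fun rho => rho 0 = F (rho 1) (rho 2)) ->
  definable_term t -> definable_term u ->
  definable_term (fun rho => F (t rho) (u rho)).
Proof.
move=> dF dt du.
apply: (@definable_equiv (fun rho => forall a b, a = t (fun i => rho i.+1) ->
   b = u (fun i => rho i.+1) -> rho 0 = F a b)).
  by move=> rho; split=> [|H a b -> ->] //; apply.
apply: definable_all; apply: definable_all; apply: definable_imp.
  exact: (definable_sub (fun i => inl (if i is j.+1 then j.+3 else 1)) dt).
apply: definable_imp.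
  exact: (definable_sub (fun i => inl (if i is j.+1 then j.+3 else 0)) du).
by apply: (definable_sub
  (fun i => inl (match i with 0 => 2 | 1 => 1 | _ => 0 end)) dF).
Qed.

End Definability.

(** * Set theory in a model *)

Create HintDb definability.

Ltac dfn_step :=
  lazymatch goal with
  | |- definable_term _ _ =>
      first [ apply definable_param | apply definable_var
            | assumption | solve [auto with definability nocore] ]
  | |- definable _ _ =>
      first [ assumption | apply definable_const
            | apply definable_mem | apply definable_eq
            | apply definable_and | apply definable_or | apply definable_iff
            | apply definable_not | apply definable_imp
            | apply definable_all | apply definable_ex ]
  end.

Ltac dfn := autounfold with definability; repeat (cbv beta; dfn_step).

Create HintDb formulas.
Create HintDb set_formulas.
Hint Unfold FAllIn FExIn is_empty is_subset is_upair is_succ is_inductive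
  ax_extensionality ax_pairing ax_union ax_power ax_infinity ax_regularity
  : formulas.

Ltac den_step :=
  lazymatch goal with
  | |- denotes _ _ (FAnd _ _) _ => apply: denotes_and
  | |- denotes _ _ (FOr _ _) _ => apply: denotes_or
  | |- denotes _ _ (FIff _ _) _ => apply: denotes_iff
  | |- denotes _ _ (FNeg _) _ => apply: denotes_neg
  | |- denotes _ _ (FEx _) _ => apply: denotes_ex; let d := fresh "d" in intro d
  | |- denotes _ _ (FImp _ _) _ => apply: denotes_imp
  | |- denotes _ _ (FAll _) _ => apply: denotes_all; let d := fresh "d" in intro d
  | |- denotes _ _ (FMem _ _) _ => exact: iff_refl
  | |- denotes _ _ (FEq _ _) _ => exact: iff_refl
  end.

Ltac den := autounfold with formulas; repeat den_step.

Section SetTheory.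
Variables (M : countType) (E : M -> M -> Prop).
Variable rho0 : nat -> M.
Hypothesis modelZF : forall q rho, ZF q -> sat E rho q.

Local Notation "x ∊ y" := (E x y) (at level 70).
Local Notation definable := (definable E).
Local Notation definable_term := (definable_term E).

Implicit Types (x y z u v w a b c s t f g n X Y A B C : M) (l : seq M).

Definition subset A B := forall x, x ∊ A -> x ∊ B.

Lemma sat_denotes rho p P : denotes E rho p P -> sat E rho p -> P.
Proof. by case. Qed.

Lemma extensionality A B : (forall u, u ∊ A <-> u ∊ B) -> A = B.
Proof.
move: A B; apply: sat_denotes (modelZF rho0 ZF_extensionality); den.
Qed.

Lemma separation (P : M -> Prop) X : definable (fun rho => P (rho 0)) ->
  exists Y, forall z, z ∊ Y <-> z ∊ X /\ P z.
Proof.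
move=> [p [e pe] ].
(* All argument variables of [p] become the variable 0 of the scheme, and a parameter variable [i]
   becomes [i.+1]. The assignment [rho] supplies the parameters, with [X] as a filler elsewhere. *)
pose q := rename (fun i => if e i is inl _ then 0 else i.+1) p.
pose rho i := lookup (fun=> X) (e i).
have /(_ rho) := sat_closure (fun r => modelZF r (ZF_separation q)).
suff: denotes E rho (∀ ∃ ∀ (0 ∈ 1 ⇔ 0 ∈ 2 ∧ q[[ [:: 0], 3 ]]))%F
   (forall X, exists Y, forall z, z ∊ Y <-> z ∊ X /\ P z).
  by move=> /sat_denotes H /H.
den; rewrite /denotes /q rename_comp sat_rename (pe (fun=> d1)).
apply: sat_ext => i _ /=; rewrite /rho /inst; case e_i: (e i) => //=.
by rewrite add0n subn1 e_i.
Qed.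

Definition is_set_succ y x := forall u, u ∊ y <-> u ∊ x \/ u = x.

Definition inductive w :=
  (exists x, x ∊ w /\ forall u, ~ u ∊ x) /\
  (forall x, x ∊ w -> exists y, y ∊ w /\ is_set_succ y x).

Lemma infinity : exists w, inductive w.
Proof. by apply: sat_denotes (modelZF rho0 ZF_infinity); den. Qed.

Lemma ex_empty : exists x, forall u, ~ u ∊ x.
Proof. by have [w [ [x [_ x0] ] _] ] := infinity; exists x. Qed.

Lemma pairing x y : exists z, forall u, u ∊ z <-> u = x \/ u = y.
Proof. by move: x y; apply: sat_denotes (modelZF rho0 ZF_pairing); den. Qed.

Lemma union x : exists y, forall u, u ∊ y <-> exists v, v ∊ x /\ u ∊ v.
Proof. by move: x; apply: sat_denotes (modelZF rho0 ZF_union); den. Qed.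

Lemma power x : exists y, forall u, u ∊ y <-> subset u x.
Proof. by move: x; apply: sat_denotes (modelZF rho0 ZF_power); den. Qed.

Lemma regularity x :
  ~ (forall u, ~ u ∊ x) -> exists y, y ∊ x /\ ~ exists z, z ∊ y /\ z ∊ x.
Proof. by move: x; apply: sat_denotes (modelZF rho0 ZF_regularity); den. Qed.

(** These operations are picked by description in the metatheory; extensionality determines their
    values. *)
Definition emp := sval (cid ex_empty).
Definition upair x y := sval (cid (pairing x y)).
Definition bigcup x := sval (cid (union x)).
Definition pow x := sval (cid (power x)).
Definition cup x y := bigcup (upair x y).
Definition adj s x := cup s (upair x x).
Definition opair x y := upair (upair x x) (upair x y).

Lemma in_emp u : ~ u ∊ emp.
Proof. by rewrite /emp; case: cid. Qed.

Lemma in_upair x y u : u ∊ upair x y <-> u = x \/ u = y.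
Proof. by rewrite /upair; case: cid. Qed.

Lemma in_bigcup x u : u ∊ bigcup x <-> exists v, v ∊ x /\ u ∊ v.
Proof. by rewrite /bigcup; case: cid. Qed.

Lemma in_pow x u : u ∊ pow x <-> subset u x.
Proof. by rewrite /pow; case: cid. Qed.

Lemma in_cup x y u : u ∊ cup x y <-> u ∊ x \/ u ∊ y.
Proof.
rewrite in_bigcup; split=> [ [v [/in_upair[->|->] uv] ]|[ux|uy] ]; auto.
  by exists x; split=> //; apply/in_upair; left.
by exists y; split=> //; apply/in_upair; right.
Qed.

Lemma in_adj s x u : u ∊ adj s x <-> u ∊ s \/ u = x.
Proof. by rewrite in_cup in_upair; tauto. Qed.

Lemma empE x : (forall u, ~ u ∊ x) -> x = emp.
Proof. by move=> x0; apply: extensionality => u; split=> [/x0|/in_emp]. Qed.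

Lemma not_in_self x : ~ x ∊ x.
Proof.
move=> xx; have [|y [/in_upair y_x n] ] := @regularity (upair x x).
  by move/(_ x); apply; apply/in_upair; left.
by apply: n; exists x; rewrite in_upair; case: y_x => ->; auto.
Qed.

Lemma upair_eq x y z w : upair x y = upair z w ->
  x = z /\ y = w \/ x = w /\ y = z.
Proof.
move=> eq_p.
have hx : x = z \/ x = w by apply/in_upair; rewrite -eq_p; apply/in_upair; auto.
have hy : y = z \/ y = w by apply/in_upair; rewrite -eq_p; apply/in_upair; auto.
have hz : z = x \/ z = y by apply/in_upair; rewrite eq_p; apply/in_upair; auto.
have hw : w = x \/ w = y by apply/in_upair; rewrite eq_p; apply/in_upair; auto.
by intuition congruence.
Qed.

Lemma opair_inj x y z w : opair x y = opair z w -> x = z /\ y = w.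
Proof.
move=> /upair_eq[] [/upair_eq e1 /upair_eq e2]; firstorder congruence.
Qed.

Lemma definable_upair (t u : (nat -> M) -> M) : definable_term t -> definable_term u ->
  definable_term (fun rho => upair (t rho) (u rho)).
Proof.
apply: definable_term2; apply: (@definable_equiv _ _
  (fun rho => forall v, v ∊ rho 0 <-> v = rho 1 \/ v = rho 2)); last by dfn.
move=> rho; split=> [H|-> v]; last by rewrite in_upair.
by apply: extensionality => v; rewrite H in_upair.
Qed.

Lemma definable_opair (t u : (nat -> M) -> M) : definable_term t -> definable_term u ->
  definable_term (fun rho => opair (t rho) (u rho)).
Proof. by move=> dt du; do 2!apply: definable_upair => //. Qed.

Lemma definable_adj (t u : (nat -> M) -> M) : definable_term t -> definable_term u ->
  definable_term (fun rho => adj (t rho) (u rho)).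
Proof.
apply: definable_term2; apply: (@definable_equiv _ _
  (fun rho => forall v, v ∊ rho 0 <-> v ∊ rho 1 \/ v = rho 2)); last by dfn.
move=> rho; split=> [H|-> v]; last by rewrite in_adj.
by apply: extensionality => v; rewrite H in_adj.
Qed.

Hint Extern 1 (definable_term (fun _ => opair _ _)) =>
  apply: definable_opair; cbv beta; dfn_step : definability.
Hint Extern 1 (definable_term (fun _ => adj _ _)) =>
  apply: definable_adj; cbv beta; dfn_step : definability.

(** * Functions and equinumerosity *)

Definition maps f x y := opair x y ∊ f.

(** This and the next definitions follow the corresponding formulas connective by connective, so
    that [den_set] can match them. *)
Definition function_on f A :=
  (forall z, z ∊ f -> exists x, x ∊ A /\ exists y, z = opair x y) /\
  (forall x, x ∊ A -> exists y, maps f x y /\ forall y', maps f x y' -> y' = y).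
Definition function f A B :=
  function_on f A /\ (forall x y, maps f x y -> y ∊ B).
Definition injection f A B :=
  function f A B /\ (forall x x' y, maps f x y /\ maps f x' y -> x = x').
Definition bijection f A B :=
  injection f A B /\ (forall y, y ∊ B -> exists x, maps f x y).
Definition equi A B := exists f, bijection f A B.

Hint Unfold subset is_set_succ inductive maps function_on function injection
  bijection equi : definability.

(** Pairs from [A] and [B] lie in the double power set of their union, so Separation yields the
    graph. *)
Lemma graph (Q : M -> M -> Prop) A B :
  definable (fun rho => Q (rho 0) (rho 1)) ->
  exists f, forall z,
    z ∊ f <-> exists x y, x ∊ A /\ y ∊ B /\ z = opair x y /\ Q x y.
Proof.
move=> dQ.
have [|f fE] := @separation (fun z => exists x y,
    x ∊ A /\ y ∊ B /\ z = opair x y /\ Q x y) (pow (pow (cup A B))).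
  by dfn; apply: (definable_sub (fun i => inl (if i is 0 then 1 else 0)) dQ).
exists f => z; rewrite fE; split=> [ []//|H]; split=> //.
have [x [y [xA [yB [-> _] ] ] ] ] := H.
apply/in_pow => u /in_upair[->|->]; apply/in_pow => v /in_upair[->|->];
  by apply/in_cup; auto.
Qed.

Lemma maps_graph (Q : M -> M -> Prop) A B f :
  (forall z, z ∊ f <-> exists x y, x ∊ A /\ y ∊ B /\ z = opair x y /\ Q x y) ->
  forall x y, maps f x y <-> x ∊ A /\ y ∊ B /\ Q x y.
Proof.
move=> fE x y; rewrite /maps fE; split=> [|[xA [yB Qxy] ] ]; last by exists x, y.
by case=> x' [y' [xA [yB [/opair_inj[-> ->] Q'] ] ] ].
Qed.

Lemma function_graph (Q : M -> M -> Prop) A B f :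
  (forall z, z ∊ f <-> exists x y, x ∊ A /\ y ∊ B /\ z = opair x y /\ Q x y) ->
  (forall x, x ∊ A -> exists y, y ∊ B /\ Q x y) ->
  (forall x y y', x ∊ A -> y ∊ B -> y' ∊ B -> Q x y -> Q x y' -> y' = y) ->
  function f A B.
Proof.
move=> fE tot fct; have mapsE := maps_graph fE; (split; first split).
- by move=> z /fE[x [y [xA [yB [-> _] ] ] ] ]; exists x; split=> //; exists y.
- move=> x xA; have [y [yB Qxy] ] := tot x xA; exists y; split.
    exact/mapsE.
  by move=> y' /mapsE[_ [y'B Qxy'] ]; apply: (fct x).
- by move=> x y /mapsE[_ [] ].
Qed.

Lemma equi_intro (Q : M -> M -> Prop) A B :
  definable (fun rho => Q (rho 0) (rho 1)) ->
  (forall x, x ∊ A -> exists y, y ∊ B /\ Q x y) ->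
  (forall y, y ∊ B -> exists x, x ∊ A /\ Q x y) ->
  (forall x y y', x ∊ A -> y ∊ B -> y' ∊ B -> Q x y -> Q x y' -> y' = y) ->
  (forall x x' y, x ∊ A -> x' ∊ A -> y ∊ B -> Q x y -> Q x' y -> x = x') ->
  equi A B.
Proof.
move=> /(@graph Q A B)[f fE] tot surj fct inj.
have mapsE := maps_graph fE.
exists f; (split; first split); first exact: function_graph fE tot fct.
  move=> x x' y [/mapsE[xA [yB Qxy] ] /mapsE[x'A [_ Qx'y] ] ].
  exact: (inj x x' y).
by move=> y yB; have [x [xA Qxy] ] := surj y yB; exists x; apply/mapsE.
Qed.

Lemma function_maps f A B x y : function f A B -> maps f x y -> x ∊ A /\ y ∊ B.
Proof.
move=> [ [dom _] cod] fxy; split; last exact: cod fxy.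
by have [x' [x'A [y' /opair_inj[-> _] ] ] ] := dom _ fxy.
Qed.

Lemma function_uniq f A B x y y' :
  function f A B -> maps f x y -> maps f x y' -> y = y'.
Proof.
move=> fAB fxy fxy'; have [xA _] := function_maps fAB fxy.
by have [z [_ uz] ] := fAB.1.2 _ xA; rewrite (uz _ fxy) (uz _ fxy').
Qed.

Lemma equi_elim A B : equi A B -> exists f,
  [/\ forall x, x ∊ A -> exists y, maps f x y,
      forall y, y ∊ B -> exists x, maps f x y,
      forall x y, maps f x y -> x ∊ A /\ y ∊ B,
      forall x y y', maps f x y -> maps f x y' -> y' = y
    & forall x x' y, maps f x y -> maps f x' y -> x = x'].
Proof.
move=> [f [ [fAB inj] surj] ]; exists f; split=> //.
- by move=> x /fAB.1.2[y [fxy _] ]; exists y.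
- by move=> x y; apply: function_maps fAB.
- by move=> x y y' fxy fxy'; apply: function_uniq fAB fxy' fxy.
- by move=> x x' y fxy fx'y; exact: inj (conj fxy fx'y).
Qed.

Lemma equi_emp A : equi A emp <-> A = emp.
Proof.
split=> [/equi_elim[f [tot _ fAB _ _] ]|->].
  by apply: empE => x /tot[y /fAB[_ /in_emp] ].
apply: (@equi_intro (fun _ _ => False)) => [|x /in_emp|x /in_emp||] //.
exact: definable_const.
Qed.

(** The point [x] is matched with [n], which is new because no set is a member of itself. *)
Lemma equi_up A n x : ~ x ∊ A -> equi A n -> equi (adj A x) (adj n n).
Proof.
move=> xA /equi_elim[f [tot surj fAB fct inj] ].
have nn := @not_in_self n.
apply: (@equi_intro (fun u y => maps f u y \/ u = x /\ y = n)).
- by dfn.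
- move=> u /in_adj[/tot[y fuy]|->].
    by exists y; split; [apply/in_adj; left; case: (fAB _ _ fuy) | left].
  by exists n; split; [apply/in_adj; right | right].
- move=> y /in_adj[/surj[u fuy]|->].
    by exists u; split; [apply/in_adj; left; case: (fAB _ _ fuy) | left].
  by exists x; split; [apply/in_adj; right | right].
- move=> u y y' _ _ _ [fuy|[-> ->] ] [fuy'|[eu ->] ] //.
  + exact: fct fuy fuy'.
  + by case: xA; rewrite -eu; case: (fAB _ _ fuy).
  + by case: xA; case: (fAB _ _ fuy').
- move=> u u' y _ _ _ [fuy|[-> ->] ] [fu'y|[-> ey] ] //.
  + exact: inj fuy fu'y.
  + by case: nn; rewrite -{1}ey; case: (fAB _ _ fuy).
  + by case: nn; case: (fAB _ _ fu'y).
Qed.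

Lemma equi_down A n : equi A (adj n n) ->
  exists x A', [/\ ~ x ∊ A', A = adj A' x & equi A' n].
Proof.
move=> /equi_elim[f [tot surj fAB fct inj] ]; have nn := @not_in_self n.
have [x fxn] : exists x, maps f x n by apply: surj; apply/in_adj; right.
have [|A' A'E] := @separation (fun u => u <> x) A; first by dfn.
exists x, A'; split; first by case/A'E.
  apply: extensionality => u; rewrite in_adj A'E.
  split=> [uA|[ []//|->] ]; last by case: (fAB _ _ fxn).
  by have [->|] := pselect (u = x); auto.
apply: (@equi_intro (fun u y => maps f u y)).
- by dfn.
- move=> u /A'E[/tot[y fuy] ux]; exists y; split=> //.
  have [_ /in_adj[//|ey] ] := fAB _ _ fuy.
  by case: ux; apply: inj fuy _; rewrite ey.
- move=> y yn; have [|u fuy] := surj y; first by apply/in_adj; left.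
  exists u; split=> //; apply/A'E; split; first by case: (fAB _ _ fuy).
  by move=> eu; rewrite eu in fuy; apply: nn; rewrite -{1}(fct _ _ _ fxn fuy).
- by move=> u y y' _ _ _; apply: fct.
- by move=> u u' y _ _ _; apply: inj.
Qed.

(** * Natural numbers and finite sets *)

Definition natural n := forall w, inductive w -> n ∊ w.
Definition finite A := exists n, natural n /\ equi A n.

Hint Unfold natural finite : definability.

Lemma natural_emp : natural emp.
Proof. by move=> w [ [x [xw /empE<-] ] _]. Qed.

Lemma natural_succ n : natural n -> natural (adj n n).
Proof.
move=> nn w indw; have [y [yw yE] ] := indw.2 n (nn w indw).
by have -> : adj n n = y by apply: extensionality => u; rewrite in_adj yE.
Qed.

(** Induction is restricted to definable properties because a model may have nonstandard natural
    numbers. Separation cuts the naturals with [P] out of an inductive set; the result is inductive,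
    so it contains every natural number. *)
Lemma natural_ind (P : M -> Prop) : definable (fun rho => P (rho 0)) ->
  P emp -> (forall n, natural n -> P n -> P (adj n n)) ->
  forall n, natural n -> P n.
Proof.
move=> dP P0 PS n nn; have [w indw] := infinity.
have [|W WE] := @separation (fun n => natural n /\ P n) w; first by dfn.
suff /WE[_ [] ] : n ∊ W by [].
apply: nn; split.
  exists emp; split; last exact: in_emp.
  by apply/WE; do 2?split=> //; apply: natural_emp.
move=> k /WE[kw [nk Pk] ]; exists (adj k k); split; last by move=> u; apply: in_adj.
have nk1 := natural_succ nk.
by apply/WE; do 2?split=> //; [exact: nk1 | apply: PS].
Qed.

Lemma finite_emp : finite emp.
Proof. by exists emp; split; [apply: natural_emp | apply/equi_emp]. Qed.

Lemma finite_adj A x : finite A -> finite (adj A x).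
Proof.
move=> [n [nn An] ]; have [xA|xA] := pselect (x ∊ A).
  have -> : adj A x = A; last by exists n.
  by apply: extensionality => u; rewrite in_adj; split=> [ [//|->//]|]; left.
by exists (adj n n); split; [apply: natural_succ | apply: equi_up].
Qed.

Lemma finite_ind (P : M -> Prop) : definable (fun rho => P (rho 0)) ->
  P emp -> (forall A x, ~ x ∊ A -> P A -> P (adj A x)) ->
  forall A, finite A -> P A.
Proof.
move=> dP P0 PS A [n [nn] ]; move: n nn A.
apply: (@natural_ind (fun n => forall A, equi A n -> P A)).
- by dfn; apply: (definable_sub (fun i => inl 0) dP).
- by move=> A /equi_emp ->.
- move=> n _ IH A /equi_down[x [A' [xA' -> /IH PA'] ] ].
  exact: PS.
Qed.

Lemma finite_sub A B : finite A -> subset B A -> finite B.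
Proof.
move=> finA; move: A finA B.
apply: (@finite_ind (fun A => forall B, subset B A -> finite B)).
- by dfn.
- by move=> B B0; rewrite (@empE B) => [|u /B0/in_emp//]; apply: finite_emp.
move=> A x xA IH B BA.
have [|C CE] := @separation (fun u => u <> x) B; first by dfn.
have finC : finite C.
  by apply: IH => u /CE[/BA/in_adj[] ].
have [xB|xB] := pselect (x ∊ B); last first.
  have <- : C = B; last by [].
  apply: extensionality => u; rewrite CE; split=> [ []//|uB].
  by split=> // ux; apply: xB; rewrite -ux.
have -> : B = adj C x; last exact: finite_adj.
apply: extensionality => u; rewrite in_adj CE.
by split=> [uB|[ []//|->//] ]; have [->|] := pselect (u = x); auto.
Qed.

(** * Lists of the metatheory and standard cardinalities *)

Definition adjs s l := foldr (fun x t => adj t x) s l.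
Definition setl l := adjs emp l.

Lemma in_adjs s l u : u ∊ adjs s l <-> u ∊ s \/ u \in l.
Proof.
elim: l => [|x l IH] /=; first by rewrite in_nil; split; [left | case].
rewrite in_adj IH in_cons; split=> [ [ []|->]|[|/predU1P[->|] ] ];
  rewrite ?eqxx; auto.
by move=> ->; rewrite orbT; auto.
Qed.

Lemma in_setl l u : u ∊ setl l <-> u \in l.
Proof. by rewrite in_adjs; split=> [ [/in_emp []|]|]; auto. Qed.

Lemma finite_adjs s l : finite s -> finite (adjs s l).
Proof. by elim: l => //= x l IH /IH; apply: finite_adj. Qed.

(** The size of [A] may be nonstandard, so the induction is internal and runs over subsets of [A];
    each step adds one fibre, which is covered by a list of the metatheory. *)
Lemma finite_union (Q : M -> M -> Prop) A B :
  definable (fun rho => Q (rho 0) (rho 1)) -> finite A ->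
  (forall a, a ∊ A -> exists l, forall y, Q a y -> y \in l) ->
  (forall y, y ∊ B -> exists a, a ∊ A /\ Q a y) -> finite B.
Proof.
move=> dQ finA fib BQ.
suff /(_ A finA) H : forall C, finite C -> subset C A ->
    forall B, (forall y, y ∊ B -> exists a, a ∊ C /\ Q a y) -> finite B.
  by apply: H BQ.
apply: (@finite_ind (fun C => subset C A ->
  forall B, (forall y, y ∊ B -> exists a, a ∊ C /\ Q a y) -> finite B)).
- by dfn; apply: (definable_sub (fun i => inl i) dQ).
- move=> _ {BQ}B BQ; suff -> : B = emp by apply: finite_emp.
  by apply: empE => y /BQ[a [/in_emp] ].
move=> C a aC IH CA {BQ}B BQ.
have [|B' B'E] := @separation (fun y => exists c, c ∊ C /\ Q c y) B.
  by dfn; apply: (definable_sub (fun i => inl i) dQ).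
have [|l lE] := fib a; first by apply: CA; apply/in_adj; right.
apply: (@finite_sub (adjs B' l)).
  apply: finite_adjs; apply: IH => [u uC|y /B'E[]//].
  by apply: CA; apply/in_adj; left.
move=> y yB; apply/in_adjs; have [c [/in_adj[cC|->] Qy] ] := BQ y yB.
  by left; apply/B'E; split=> //; exists c.
by right; apply: lE.
Qed.

Definition num (n : nat) := iter n (fun x => adj x x) emp.
Definition card (n : nat) s := equi s (num n).

Hint Unfold card : definability.

(** The bridge to the metatheory: [n] is a standard number, so elements can be added or removed one
    at a time by an external induction. *)
Lemma cardP (n : nat) s : card n s <->
  exists l, [/\ uniq l, size l = n & forall x, x ∊ s <-> x \in l].
Proof.
rewrite /card; elim: n s => [|n IH] s /=.
  rewrite equi_emp; split=> [->|[l [_ /size0nil-> sE] ] ].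
    by exists [::]; split=> // x; split=> // /in_emp.
  by apply: empE => u /sE.
split=> [/equi_down[x [s' [xs' -> /IH[l [Ul sl lE] ] ] ] ]|[ [|x l] [] ] //].
  exists (x :: l); split=> /=; [|by rewrite sl|].
    by rewrite Ul andbT; apply/negP => /lE.
  move=> u; rewrite in_adj lE in_cons.
  by split=> [ [->|->]|/predU1P[->|] ]; rewrite ?eqxx ?orbT; auto.
move=> /= /andP[xl Ul] [sl] lE.
have -> : s = adj (setl l) x.
  apply: extensionality => u; rewrite lE in_adj in_setl in_cons.
  by split=> [/predU1P[->|]|[->|->] ]; rewrite ?eqxx ?orbT; auto.
apply: equi_up; first by rewrite in_setl; apply/negP.
by apply/IH; exists l; split=> // u; apply: in_setl.
Qed.

Lemma card_setl l : uniq l -> card (size l) (setl l).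
Proof. by move=> Ul; apply/cardP; exists l; split=> // x; apply: in_setl. Qed.

(** * The two principles in a model *)

Lemma denotes_equiv rho p P Q : denotes E rho p P -> (P <-> Q) -> denotes E rho p Q.
Proof. by rewrite /denotes => -> ->. Qed.

Lemma denotes_upair rho i j k :
  denotes E rho (is_upair k i j) (rho k = upair (rho i) (rho j)).
Proof.
apply: (@denotes_equiv _ _ (forall u, u ∊ rho k <-> u = rho i \/ u = rho j)).
  by den.
split=> [H|-> u]; last exact: in_upair.
by apply: extensionality => u; rewrite H in_upair.
Qed.

Lemma denotes_opair rho i j k :
  denotes E rho (is_opair k i j) (rho k = opair (rho i) (rho j)).
Proof.
apply: (@denotes_equiv _ _ (exists a b, a = upair (rho i) (rho i) /\
    b = upair (rho i) (rho j) /\ rho k = upair a b)).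
  by rewrite /is_opair; den; apply: denotes_upair.
by split=> [ [a [b [-> [-> //] ] ] ]|->]; do 2!eexists; split; [| split].
Qed.

Lemma denotes_maps rho i j k :
  denotes E rho (Defs.maps k i j) (maps (rho k) (rho i) (rho j)).
Proof.
apply: (@denotes_equiv _ _ (exists z, z ∊ rho k /\ z = opair (rho i) (rho j))).
  by rewrite /Defs.maps; den; apply: denotes_opair.
by rewrite /maps; split=> [ [z [zk <-] ]|H] //; eexists; split; first exact: H.
Qed.

Lemma denotes_succ rho i k :
  denotes E rho (is_succ k i) (rho k = adj (rho i) (rho i)).
Proof.
apply: (@denotes_equiv _ _ (is_set_succ (rho k) (rho i))); first by den.
split=> [H|-> u]; last exact: in_adj.
by apply: extensionality => u; rewrite H in_adj.
Qed.

Hint Unfold is_function_on is_function is_injection is_bijection equinumerous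
  is_natural is_infinite is_choice_function FAllIn FExIn is_inductive is_empty
  is_succ : set_formulas.

Ltac den_set := autounfold with set_formulas;
  repeat first [den_step | apply: denotes_opair | apply: denotes_maps].

Lemma denotes_infinite rho (X : nat) : denotes E rho (is_infinite X) (~ finite (rho X)).
Proof. by den_set. Qed.

Lemma denotes_numeral rho (n x : nat) :
  denotes E rho (is_numeral n x) (rho x = num n).
Proof.
elim: n x rho => [|n IH] x rho /=.
  apply: (@denotes_equiv _ _ (forall u, ~ u ∊ rho x)); first by den.
  by split=> [/empE|-> u /in_emp].
apply: (@denotes_equiv _ _ (exists y, y = num n /\ rho x = adj y y)).
  by den_step; den_step; [apply: IH | apply: denotes_succ].
by split=> [ [y [-> ] ]|->] //; exists (num n).
Qed.

Lemma denotes_card rho (n A : nat) :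
  denotes E rho (has_card n A) (card n (rho A)).
Proof.
apply: (@denotes_equiv _ _ (exists y, y = num n /\ equi (rho A) y)).
  by rewrite /has_card; den_step; den_step; [apply: denotes_numeral | den_set].
by split=> [ [y [-> ] ]|H] //; exists (num n).
Qed.

Definition card_atmost (n : nat) A := exists f, injection f A (num n).

Lemma denotes_card_le rho (n A : nat) :
  denotes E rho (card_le n A) (card_atmost n (rho A)).
Proof.
apply: (@denotes_equiv _ _ (exists y, y = num n /\ exists f, injection f (rho A) y)).
  by rewrite /card_le; den_step; den_step; [apply: denotes_numeral | den_set].
by split=> [ [y [-> ] ]|H] //; exists (num n).
Qed.

Definition ramsey (m n : nat) := forall X P C h,
  ~ finite X /\ (forall s, s ∊ P <-> subset s X /\ card m s) /\ ~ finite C /\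
  function h P C /\
  (forall c, c ∊ C ->
     exists F, (forall s, s ∊ F <-> maps h s c) /\ card_atmost n F) ->
  exists Y, subset Y X /\ ~ finite Y /\
    forall s t, (subset s Y /\ card m s) /\ (subset t Y /\ card m t) /\ s <> t ->
      ~ exists c, maps h s c /\ maps h t c.

Lemma denotes_RRT rho (m n : nat) : denotes E rho (RRT m n) (ramsey m n).
Proof.
rewrite /RRT /is_subsets /in_subsets /is_bounded /is_polychromatic /in_subsets.
autounfold with formulas.
do ?first [apply: denotes_infinite | apply: denotes_card_le | apply: denotes_card
  | apply: denotes_maps | den_step].
by rewrite /is_function; den_set.
Qed.

Definition choice_function f B :=
  function_on f B /\ forall a, a ∊ B -> forall x, maps f a x -> x ∊ a.

Definition choice_minus (n : nat) := forall A,
  ~ finite A /\ (forall a, a ∊ A -> card n a) ->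
  exists B, subset B A /\ ~ finite B /\ exists f, choice_function f B.

Lemma denotes_AC_minus rho (n : nat) :
  denotes E rho (AC_minus n) (choice_minus n).
Proof.
rewrite /AC_minus /is_choice_function; autounfold with formulas.
do ?first [apply: denotes_infinite | apply: denotes_card
  | apply: denotes_maps | den_step].
by den_set.
Qed.

(** * From colourings to choice functions *)

Lemma num_sub (i j : nat) : i <= j -> subset (num i) (num j).
Proof.
move=> /subnK <-; elim: (j - i) => //= d IH x xi.
by apply/in_adj; left; apply: IH.
Qed.

Lemma card_atmost_seq (r : nat) A l :
  size l <= r -> (forall x, x ∊ A -> x \in l) -> card_atmost r A.
Proof.
move=> lr Al; pose l' := undup [seq x <- l | `[< x ∊ A >] ].
have AE : setl l' = A.
  apply: extensionality => x; rewrite in_setl mem_undup mem_filter.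
  split=> [/andP[/asboolP]|xA] //.
  by apply/andP; split; [apply/asboolP | apply: Al].
have [f [ [ [fon cod] inj] _] ] := card_setl (undup_uniq [seq x <- l | `[< x ∊ A >] ]).
rewrite AE in fon; exists f; split=> //; split=> // x y /cod.
apply: num_sub; rewrite (leq_trans (size_undup _)) // size_filter.
exact: leq_trans (count_size _ _) lr.
Qed.

(** Colour each [m]-element subset of [X] by its [R]-class among these subsets. *)
Lemma rainbow (m r : nat) X (R : M -> M -> Prop) : ramsey m r -> ~ finite X ->
  definable (fun rho => R (rho 0) (rho 1)) ->
  (forall s, R s s) -> (forall s t, R s t -> R t s) ->
  (forall s t u, R s t -> R t u -> R s u) ->
  (forall s, subset s X -> card m s -> exists l, size l <= r /\
     forall t, subset t X -> card m t -> R s t -> t \in l) ->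
  exists Y, [/\ subset Y X, ~ finite Y &
    forall s t, subset s Y -> card m s -> subset t Y -> card m t ->
      R s t -> s = t].
Proof.
move=> ram infX dR Rxx Rsym Rtr bound.
have [|P PE] := @separation (fun s => card m s) (pow X); first by dfn.
have {}PE s : s ∊ P <-> subset s X /\ card m s by rewrite PE in_pow.
(* The classes are members of [pow P]; [X] is joined to them so that the set of colours is
   infinite. *)
pose C := cup X (pow P).
have infC : ~ finite C.
  by apply: contra_not infX => finC; apply: finite_sub finC _ => x; rewrite in_cup; left.
pose Q s c := forall t, t ∊ c <-> t ∊ P /\ R s t.
have clsP s : exists c, c ∊ C /\ Q s c.
  have [|c cE] := @separation (R s) P.
    by apply: (definable_sub (fun i => if i is 0 then inr s else inl 0) dR).
  by exists c; split=> //; apply/in_cup; right; apply/in_pow => t /cE[].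
have [|h hE] := @graph Q P C.
  by rewrite /Q; dfn; apply: (definable_sub (fun i => inl (if i is 0 then 1 else 0)) dR).
have mapsE := maps_graph hE.
have [|Y [YX [infY polyY] ] ] := ram X P C h.
  split=> //; split=> //; split=> //; split.
    apply: (function_graph hE) => [s _|s c c' _ _ _ Qc Qc']; first exact: clsP.
    by apply: extensionality => t; rewrite (Qc t) (Qc' t).
  move=> c cC; have [|F FE] := @separation (fun s => maps h s c) P; first by dfn.
  have {}FE s : s ∊ F <-> maps h s c.
    by rewrite FE; split=> [ []//|hsc]; split=> //; have /mapsE[] := hsc.
  exists F; split=> //.
  (* A nonempty fibre of the colouring is contained in the class of any of its members. *)
  have [ [s0 s0F]|nF] := pselect (exists s, s ∊ F); last first.
    by apply: (@card_atmost_seq _ _ [::]) => // s sF; case: nF; exists s.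
  have /FE/mapsE[s0P [_ Qs0] ] := s0F.
  have /PE[s0X s0m] := s0P.
  have [l [lr lE] ] := bound s0 s0X s0m.
  apply: card_atmost_seq lr _ => t /FE/mapsE[tP [_ Qt] ].
  have /PE[tX tm] := tP; apply: lE => //.
  by have /Qs0[] : t ∊ c by apply/Qt.
exists Y; split=> // s t sY sm tY tm Rst; apply: contrapT => nst.
have sP : s ∊ P by apply/PE; split=> // x /sY/YX.
have tP : t ∊ P by apply/PE; split=> // x /tY/YX.
case: (polyY s t) => //; have [c [cC Qs] ] := clsP s.
exists c; split; apply/mapsE; split=> //; split=> //; move=> u.
rewrite (Qs u); split=> -[uP Ru]; split=> //; last exact: Rtr Ru.
exact: Rtr (Rsym _ _ Rst) Ru.
Qed.

(** Points carry their fibre as a tag, because members of [A] may overlap. *)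
Definition total_space A X :=
  forall z, z ∊ X <-> exists a x, a ∊ A /\ x ∊ a /\ z = opair a x.

Lemma ex_total_space A : exists X, total_space A X.
Proof.
have [|X XE] := @graph (fun a x => x ∊ a) A (bigcup A); first by dfn.
exists X => z; rewrite XE; split=> -[a [x H] ]; exists a, x.
  by case: H => aA [_ [-> xa] ].
case: H => aA [xa ->]; split=> //; split=> //.
by apply/in_bigcup; exists a.
Qed.

Lemma in_total_space A X a x :
  total_space A X -> opair a x ∊ X <-> a ∊ A /\ x ∊ a.
Proof.
move=> XE; rewrite XE; split=> [ [a' [x' [aA [xa /opair_inj[-> ->] ] ] ] ]//|].
by case=> aA xa; exists a, x.
Qed.

(** The first projection maps [X] onto [A], as no fibre is empty. *)
Lemma infinite_total_space (n : nat) A X : 0 < n -> total_space A X ->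
  ~ finite A -> (forall a, a ∊ A -> card n a) -> ~ finite X.
Proof.
move=> n0 XE infA cA; apply: contra_not infA => finX.
apply: (@finite_union (fun z a => exists x, z = opair a x) X) => //.
- by dfn.
- move=> z /XE[a [x [_ [_ ->] ] ] ]; exists [:: a] => a' [x' /opair_inj[<- _] ].
  by rewrite mem_head.
move=> a aA; have /cardP[ [|x l] [_ sl lE] ] := cA a aA.
  by rewrite -sl in n0.
exists (opair a x); split; last by exists x.
by apply/in_total_space; first exact: XE; split=> //; apply/lE; rewrite mem_head.
Qed.

(** If only finitely many fibres met [Y], then [Y] would be a finite union of finite pieces. *)
Lemma infinite_support (n : nat) A X Y : total_space A X ->
  (forall a, a ∊ A -> card n a) -> subset Y X -> ~ finite Y ->
  exists B, [/\ forall a, a ∊ B <-> a ∊ A /\ exists x, opair a x ∊ Y & ~ finite B].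
Proof.
move=> XE cA YX infY.
have [|B BE] := @separation (fun a => exists x, opair a x ∊ Y) A; first by dfn.
exists B; split=> //; apply: contra_not infY => finB.
apply: (@finite_union (fun a y => exists x, y = opair a x /\ x ∊ a) B) => //.
- by dfn.
- move=> a /BE[/cA/cardP[l [_ _ lE] ] _].
  exists (map (opair a) l) => y [x [-> /lE xl] ].
  by apply/mapP; exists x.
move=> y yY; have /XE[a [x [aA [xa ey] ] ] ] := YX y yY.
exists a; split; last by exists x.
by apply/BE; split=> //; exists x; rewrite -ey.
Qed.

(** Each member of [B] has exactly one element singled out by [Q], so the choice function is a
    definable graph and no choice is made in the model. *)
Lemma choice_from (Q : M -> M -> Prop) B :
  definable (fun rho => Q (rho 0) (rho 1)) ->
  (forall a, a ∊ B -> exists x, x ∊ a /\ Q a x) ->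
  (forall a x y, a ∊ B -> x ∊ a -> y ∊ a -> Q a x -> Q a y -> y = x) ->
  exists f, choice_function f B.
Proof.
move=> dQ tot uniqQ.
have [|f fE] := @graph (fun a x => x ∊ a /\ Q a x) B (bigcup B); first by dfn.
exists f; split; last by move=> a aB x /(maps_graph fE)[_ [_ [] ] ].
suff [] : function f B (bigcup B) by [].
apply: (function_graph fE) => [a aB|a x y aB _ _ [xa Qx] [ya Qy] ].
  have [x [xa Qx] ] := tot a aB; exists x; split=> //.
  by apply/in_bigcup; exists a.
exact: (uniqQ a).
Qed.

(** A list of maximal length among those with distinct members satisfying [P] contains every such
    element. *)
Lemma bounded_uniq_seq (P : M -> Prop) (b : nat) :
  ~ (exists l, [/\ uniq l, size l = b & forall x, x \in l -> P x]) ->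
  exists l, forall x, P x -> x \in l.
Proof.
elim: b => [|b IH] no; first by case: no; exists [::].
have [ [l [Ul sl lP] ]|/IH//] :=
  pselect (exists l, [/\ uniq l, size l = b & forall x, x \in l -> P x]).
exists l => x Px; apply: contrapT => /negP xl; apply: no; exists (x :: l).
split=> /=; [by rewrite xl | by rewrite sl |].
by move=> y; rewrite in_cons => /predU1P[->|/lP].
Qed.

(** The fibres that meet [Y] in two points or more are all on a finite list. Dropping them from the
    support of [Y] leaves infinitely many fibres that meet [Y] in a single point. *)
Lemma choice_of_sparse (n b : nat) A X Y : total_space A X ->
  ~ finite A -> (forall a, a ∊ A -> card n a) -> subset Y X -> ~ finite Y ->
  ~ (exists l, [/\ uniq l, size l = b & forall a, a \in l ->
       exists x y, [/\ x <> y, opair a x ∊ Y & opair a y ∊ Y] ]) ->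
  exists B, subset B A /\ ~ finite B /\ exists f, choice_function f B.
Proof.
move=> XE infA cA YX infY /bounded_uniq_seq[l lE].
have [B0 [B0E infB0] ] := infinite_support XE cA YX infY.
have [|B BE] := @separation (fun a => forall x y, opair a x ∊ Y ->
  opair a y ∊ Y -> y = x) B0; first by dfn.
exists B; split; first by move=> a /BE[/B0E[] ].
split.
  apply: contra_not infB0 => /(@finite_adjs _ l) finB.
  apply: finite_sub finB _ => a aB0; apply/in_adjs.
  have [aB|aB] := pselect (a ∊ B); [by left | right; apply: lE].
  apply: contrapT => H; apply: aB; apply/BE; split=> // x y xY yY.
  by apply: contrapT => yx; apply: H; exists y, x.
apply: (@choice_from (fun a x => opair a x ∊ Y)).
- by dfn.
- move=> a /BE[/B0E[_ [x xY] ] _]; exists x; split=> //.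
  by have /(in_total_space _ _ XE)[] := YX _ xY.
- by move=> a x y /BE[_ H] _ _ xY yY; apply: H.
Qed.

(** Choice is applied in the metatheory. The functions matter only on the list [l], so the sets
    built from them still exist in the model. *)
Lemma choose_pairs Y l :
  (forall a, a \in l -> exists x y, [/\ x <> y, opair a x ∊ Y & opair a y ∊ Y]) ->
  exists fx fy : M -> M, forall a, a \in l ->
    [/\ fx a <> fy a, opair a (fx a) ∊ Y & opair a (fy a) ∊ Y].
Proof.
move=> H.
have /choice[f fP] : forall a, exists p : M * M, a \in l ->
    [/\ p.1 <> p.2, opair a p.1 ∊ Y & opair a p.2 ∊ Y].
  move=> a; have [al|al] := boolP (a \in l); last by exists (a, a).
  by have [x [y Hxy] ] := H a al; exists (x, y).
by exists (fun a => (f a).1), (fun a => (f a).2).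
Qed.

Lemma opair_graph_inj (f : M -> M) : injective (fun a => opair a (f a)).
Proof. by move=> a b /opair_inj[]. Qed.

(** * Families of two-element sets *)

Section PairFamilies.
Variables (A X : M).
Hypotheses (XE : total_space A X) (cA : forall a, a ∊ A -> card 2 a).

(** The second disjunct expresses that exchanging the two points of every fibre takes [s] to [t];
    equality is added for reflexivity. *)
Definition swapped s t := s = t \/ subset s X /\ subset t X /\
  forall a x y, a ∊ A -> x ∊ a -> y ∊ a -> x <> y ->
    (opair a x ∊ s <-> opair a y ∊ t).

Lemma other a x : a ∊ A -> x ∊ a ->
  exists y, [/\ y ∊ a, x <> y & forall z, z ∊ a -> z = x \/ z = y].
Proof.
move=> /cA/cardP[l [+ + aE] ].
case: l aE => [|p [|q [|? ?] ] ] //= aE; rewrite inE andbT => /eqP pq _.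
rewrite aE !inE => /orP[] /eqP->; [exists q | exists p].
  split=> //; first by rewrite aE !inE eqxx orbT.
  by move=> z; rewrite aE !inE => /orP[] /eqP->; auto.
split=> [|/esym//|]; first by rewrite aE !inE eqxx.
by move=> z; rewrite aE !inE => /orP[] /eqP->; auto.
Qed.

Lemma swapped_sym s t : swapped s t -> swapped t s.
Proof.
case=> [->|[sX [tX H] ] ]; [by left | right]; do 2!split=> //.
by move=> a x y aA xa ya xy; rewrite (H a y x) // => /esym.
Qed.

(** The exchange is an involution, and a subset of [X] is determined by its points over [A]. *)
Lemma swapped_twice s t u : subset s X -> subset t X -> subset u X ->
  (forall a x y, a ∊ A -> x ∊ a -> y ∊ a -> x <> y ->
    (opair a x ∊ s <-> opair a y ∊ t)) ->
  (forall a x y, a ∊ A -> x ∊ a -> y ∊ a -> x <> y ->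
    (opair a x ∊ t <-> opair a y ∊ u)) -> s = u.
Proof.
move=> sX tX uX st tu.
have su a x : a ∊ A -> x ∊ a -> opair a x ∊ s <-> opair a x ∊ u.
  move=> aA xa; have [y [ya xy _] ] := other aA xa.
  by rewrite (st a x y) // (tu a y x) // => /esym.
apply: extensionality => z; split=> [zs|zu].
  by have /XE[a [x [aA [xa ez] ] ] ] := sX z zs; rewrite ez -su // -ez.
by have /XE[a [x [aA [xa ez] ] ] ] := uX z zu; rewrite ez su // -ez.
Qed.

Lemma swapped_trans s t u : swapped s t -> swapped t u -> swapped s u.
Proof.
case=> [->//|[sX [tX st] ] ] [<-|[_ [uX tu] ] ]; first by right.
by left; apply: swapped_twice st tu.
Qed.

(** A set has at most one image under the exchange, so its class has at most two members. *)
Lemma swapped_class (r : nat) s : 1 < r -> exists l, size l <= r /\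
  forall t, swapped s t -> t \in l.
Proof.
move=> r1; have [ [t [st nst] ]|H] := pselect (exists t, swapped s t /\ s <> t).
  exists [:: s; t]; split=> // u [->|[sX [uX su] ] ]; first by rewrite inE eqxx.
  case: st => // -[_ [tX st] ]; rewrite !inE orbC.
  suff -> : u = t by rewrite eqxx.
  apply: (@swapped_twice u s t) => // a x y aA xa ya xy.
  by rewrite (su a y x) // => /esym.
exists [:: s]; split=> [|t st]; first exact: ltnW.
by rewrite inE; apply/eqP; apply: contrapT => ts; apply: H; exists t; split=> // /esym.
Qed.

Lemma choice_pairs (m r : nat) : 0 < m -> 1 < r -> ramsey m r -> ~ finite A ->
  exists B, subset B A /\ ~ finite B /\ exists f, choice_function f B.
Proof.
move=> m0 r1 ram infA.
have infX : ~ finite X by apply: infinite_total_space XE infA cA.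
have [|||||Y [YX infY polyY] ] := @rainbow m r X swapped ram infX.
- by rewrite /swapped; dfn.
- by left.
- exact: swapped_sym.
- exact: swapped_trans.
- move=> s _ _; have [l [lr lE] ] := swapped_class s r1.
  by exists l; split=> // t _ _; apply: lE.
(* If [m] fibres met [Y] in both points, one point from each and the remaining points would form two
   [m]-element subsets of [Y] exchanged with each other. *)
apply: (choice_of_sparse (b := m) XE infA cA YX infY) => -[l [Ul sl lY] ].
have [fx [fy fxy] ] := choose_pairs lY.
pose part (f : M -> M) := setl [seq opair a (f a) | a <- l].
have in_part (f : M -> M) a x : opair a x ∊ part f <-> a \in l /\ x = f a.
  rewrite in_setl; split=> [/mapP[b bl /opair_inj[-> ->] ]//|[al ->] ].
  by apply/mapP; exists a.
have part_m (f : M -> M) : card m (part f).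
  by rewrite -sl -(size_map (fun a => opair a (f a)));
    apply/card_setl; rewrite map_inj_uniq //; apply: opair_graph_inj.
have part_Y (f : M -> M) : (forall a, a \in l -> opair a (f a) ∊ Y) -> subset (part f) Y.
  by move=> H u /in_setl/mapP[a /H ? ->].
have fxY : subset (part fx) Y by apply: part_Y => a /fxy[].
have fyY : subset (part fy) Y by apply: part_Y => a /fxy[].
have eq_parts : part fx = part fy.
  apply: polyY => //; right; split; first by move=> u /fxY/YX.
  split=> [u /fyY/YX//|a x y aA xa ya xy].
  rewrite !in_part; split=> -[al e]; split=> //; have [nfxy xY yY] := fxy a al.
    have [_ fya] := (in_total_space _ _ XE).1 (YX _ yY).
    have [z [za xz zE] ] := other aA xa.
    have [ey|->] := zE y ya; first by case: xy.
    have [ey|->//] := zE (fy a) fya; by case: nfxy; rewrite -e ey.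
  have [_ fxa] := (in_total_space _ _ XE).1 (YX _ xY).
  have [z [za yz zE] ] := other aA ya.
  have [ex|->] := zE x xa; first by case: xy.
  have [ex|->//] := zE (fx a) fxa; by case: nfxy; rewrite -e ex.
(* Since [0 < m] there is at least one such fibre, and over it the two sets differ. *)
case: l Ul sl lY fxy @part in_part part_m part_Y fxY fyY eq_parts => [|a l] Ul sl.
  by rewrite -sl in m0.
move=> _ fxy part in_part _ _ _ _ eq_parts.
have [nfxy _ _] := fxy a (mem_head _ _).
have : opair a (fx a) ∊ part fy by rewrite -eq_parts in_part mem_head.
by move/in_part => [].
Qed.

End PairFamilies.

Lemma ramsey_choice2 (m n : nat) : 0 < m -> 1 < n -> ramsey m n -> choice_minus 2.
Proof.
move=> m0 n1 ram A [infA cA]; have [X XE] := ex_total_space A.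
exact (choice_pairs XE cA m0 n1 ram infA).
Qed.

(** * Fibre systems with a common base *)

Section FibreSystems.
Variables (A X : M) (n b j m r : nat).
Hypotheses (XE : total_space A X) (cA : forall a, a ∊ A -> card n a).
Hypotheses (n1 : 1 < n) (b0 : 0 < b) (jb : j <= b) (mj : m + j = b.*2).
Hypothesis (le_r : 'C(b, j) * n ^ j * 'C(n, 2) ^ (b - j) <= r).

(* [s] meets exactly the fibres over the [b] members of [B], each in at most
   two points; if it has [m = 2b - j] points, it thus consists of [b - j] pairs
   and [j] single points. *)
Definition fibre_system s B := subset s X /\ card b B /\
  (forall a, a ∊ B <-> exists x, opair a x ∊ s) /\
  (forall a x y z, opair a x ∊ s -> opair a y ∊ s -> opair a z ∊ s ->
     x = y \/ y = z \/ x = z).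

(** Equality is added for reflexivity; a set that is not a fibre system is alone in its class. *)
Definition same_base s t :=
  s = t \/ exists B, fibre_system s B /\ fibre_system t B.

Lemma same_base_sym s t : same_base s t -> same_base t s.
Proof. by case=> [->|[B [] ] ]; [left | right; exists B]. Qed.

Lemma same_base_trans s t u : same_base s t -> same_base t u -> same_base s u.
Proof.
case=> [->//|[B [sB tB] ] ] [<-|[C [tC uC] ] ]; first by right; exists B.
right; exists B; split=> //; suff <- : C = B by [].
by apply: extensionality => a; rewrite tB.2.2.1 tC.2.2.1.
Qed.

Lemma in_base s B a x : fibre_system s B -> opair a x ∊ s ->
  [/\ a ∊ B, a ∊ A & x ∊ a].
Proof.
move=> [sX [_ [BE _] ] ] xs; have [aA xa] := (in_total_space _ _ XE).1 (sX _ xs).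
by split=> //; apply/BE; exists x.
Qed.

(** Numbering the [b] fibres over [B] and the [n] points of each encodes a fibre system as a
    function from ['I_b] to subsets of ['I_n]. The codes of those with [m] points are counted by
    [card_fibre_systems]. *)
Lemma fibre_system_class s B : fibre_system s B ->
  exists l, size l <= r /\ forall t, card m t -> fibre_system t B -> t \in l.
Proof.
move=> sB; have [_ [/cardP[la [Ula sla laE] ] [BE _] ] ] := sB.
have /choice[el elP] : forall a, exists l, a ∊ B ->
    [/\ uniq l, size l = n & forall x, x ∊ a <-> x \in l].
  move=> a; have [aB|aB] := pselect (a ∊ B); last by exists [::].
  have [x xs] := (BE a).1 aB; have [_ aA _] := in_base sB xs.
  by have /cardP[l] := cA aA; exists l.
(* The default [emp] is never reached, since [la] has length [b] and each list [el (a_ i)] has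
   length [n]. *)
pose a_ (i : 'I_b) := nth emp la i.
pose x_ (i : 'I_b) (q : 'I_n) := nth emp (el (a_ i)) q.
have a_B i : a_ i ∊ B by rewrite laE mem_nth // sla.
have a_P i := elP _ (a_B i).
have a_inj : injective a_.
  move=> i i' /eqP; rewrite nth_uniq ?sla ?ltn_ord // => /eqP.
  exact: val_inj.
have x_inj i : injective (x_ i).
  have [Uel sel _] := a_P i.
  move=> q q' /eqP; rewrite nth_uniq ?sel ?ltn_ord // => /eqP.
  exact: val_inj.
have a_surj a : a ∊ B -> exists i, a = a_ i.
  rewrite laE => al; have lt_i : index a la < b by rewrite -sla index_mem.
  by exists (Ordinal lt_i); rewrite /a_ /= nth_index.
have x_surj i x : x ∊ a_ i -> exists q, x = x_ i q.
  have [_ sel elE] := a_P i; rewrite elE => xl.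
  have lt_q : index x (el (a_ i)) < n by rewrite -sel index_mem.
  by exists (Ordinal lt_q); rewrite /x_ /= nth_index.
pose pt (p : 'I_b * 'I_n) := opair (a_ p.1) (x_ p.1 p.2).
have pt_inj : injective pt.
  by move=> [i q] [i' q'] /opair_inj[/= /a_inj <- /x_inj <-].
pose realize (F : {ffun 'I_b -> {set 'I_n}}) :=
  setl [seq pt p | p <- enum [set p | p.2 \in F p.1] ].
pose S := [set F : {ffun 'I_b -> {set 'I_n}} |
  [forall i, 0 < #|F i| <= 2] && (\sum_i #|F i| == m)].
exists [seq realize F | F <- enum S]; split.
  by rewrite size_map -cardE (leq_trans (card_fibre_systems n mj)).
move=> t /cardP[lt [Ult slt ltE] ] tB.
pose F := [ffun i => [set q | `[< pt (i, q) ∊ t >] ] ] : {ffun 'I_b -> {set 'I_n}}.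
have FE i q : (q \in F i) = `[< pt (i, q) ∊ t >] by rewrite ffunE inE.
have ptE u : u ∊ t -> exists p, u = pt p.
  move=> ut; have /XE[a [x [_ [_ eu] ] ] ] := tB.1 _ ut.
  have [aB _ xa] : [/\ a ∊ B, a ∊ A & x ∊ a].
    by apply: in_base tB _; rewrite -eu.
  have [i ea] := a_surj a aB; rewrite ea in xa; have [q ex] := x_surj i x xa.
  by exists (i, q); rewrite eu ea ex.
have rF : realize F = t.
  apply: extensionality => u; rewrite in_setl; split.
    by move/mapP=> [ [i q] ]; rewrite mem_enum inE FE => /asboolP ? ->.
  move=> ut; have [ [i q] eu] := ptE u ut; apply/mapP; exists (i, q) => //.
  by rewrite mem_enum inE FE; apply/asboolP; rewrite -eu.
apply/mapP; exists F; last by [].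
rewrite mem_enum inE; apply/andP; split.
  apply/forallP => i; apply/andP; split.
    have [x xt] := (tB.2.2.1 (a_ i)).1 (a_B i).
    have [_ _ xa] := in_base tB xt; have [q ex] := x_surj i x xa.
    by apply/card_gt0P; exists q; rewrite FE; apply/asboolP; rewrite /pt /= -ex.
  rewrite leqNgt; apply/negP => /card_gt2P[q1 [q2 [q3 [] ] ] ].
  rewrite !FE => -[/asboolP h1 /asboolP h2 /asboolP h3] [/eqP n12 /eqP n23 /eqP n31].
  by case: (tB.2.2.2 _ _ _ _ h1 h2 h3) => [/x_inj//|[/x_inj//|/x_inj/esym//] ].
(* The members of [D] number the points of [t], and slicing [D] over the fibres gives the sum of the
   [#|F i|]. *)
pose D := [set p : 'I_b * 'I_n | p.2 \in F p.1].
have <- : #|D| = m.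
  rewrite cardE -(size_map pt) -slt; apply/perm_size/uniq_perm => //.
    by rewrite map_inj_uniq ?enum_uniq.
  move=> u; apply/idP/idP.
    by move=> uD; apply/ltE; rewrite -rF; apply/in_setl.
  by move/ltE; rewrite -{1}rF => /in_setl.
rewrite sum_card_fibres; apply/eqP; apply: eq_bigr => i _.
by apply: eq_card => q; rewrite !inE.
Qed.

Lemma rainbow_fibre_systems : ramsey m r -> ~ finite A ->
  exists Y, [/\ subset Y X, ~ finite Y & forall s t B, subset s Y -> card m s ->
    subset t Y -> card m t -> fibre_system s B -> fibre_system t B -> s = t].
Proof.
move=> ram infA.
have infX : ~ finite X.
  exact: infinite_total_space (ltnW n1) XE infA cA.
have [|||||Y [YX infY polyY] ] := @rainbow m r X same_base ram infX.
- by rewrite /same_base /fibre_system; dfn.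
- by left.
- exact: same_base_sym.
- exact: same_base_trans.
- move=> s sX sm; have [ [B sB]|ns] := pselect (exists B, fibre_system s B).
    have [l [lr lE] ] := fibre_system_class sB.
    exists l; split=> // t _ tm [<-|[C [sC tC] ] ]; apply: lE => //.
    suff -> : B = C by [].
    by apply: extensionality => a; rewrite sB.2.2.1 sC.2.2.1.
  (* Here the class is a singleton, and [r] is positive because the product in [le_r] is. *)
  exists [:: s]; split=> [|t _ _].
    apply: leq_trans le_r; rewrite !muln_gt0 bin_gt0 jb !expn_gt0 bin_gt0 n1.
    by rewrite (ltnW n1).
  case=> [->|[B [sB _] ] ]; first by rewrite mem_head.
  by case: ns; exists B.
exists Y; split=> // s t B sY sm tY tm sB tB; apply: polyY => //.
by right; exists B.
Qed.

(* Replacing the point of [s] in a fibre that it meets once gives another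
   fibre system with the same base. *)
Lemma choice_fibre_systems : 0 < j -> ramsey m r -> ~ finite A ->
  exists B, subset B A /\ ~ finite B /\ exists f, choice_function f B.
Proof.
move=> j0 ram infA; have [Y [YX infY polyY] ] := rainbow_fibre_systems ram infA.
apply: (choice_of_sparse (b := b) XE infA cA YX infY) => -[la [Ula sla lY] ].
have [fx [fy fxy] ] := choose_pairs lY.
case: la Ula sla {lY} fxy => [|a0 la] /=; first by move=> _ sl _; move: b0; rewrite -sl.
move=> /andP[a0la Ula] sla fxy.
(* Over the [b - 1] fibres other than [a0], take one point everywhere and a second point in all but
   [j - 1] of them. With one more point over [a0] this makes [1 + (b - 1) + (b - j) = m] points. *)
pose L := [seq opair a (fx a) | a <- la] ++ [seq opair a (fy a) | a <- drop j.-1 la].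
have drop_la a : a \in drop j.-1 la -> a \in la by apply: mem_drop.
have fla a : a \in la -> [/\ fx a <> fy a, opair a (fx a) ∊ Y & opair a (fy a) ∊ Y].
  by move=> al; apply: fxy; rewrite in_cons al orbT.
have in_L a x : opair a x \in L -> a \in la /\ (x = fx a \/ x = fy a).
  rewrite mem_cat => /orP[] /mapP[c cl /opair_inj[-> ->] ].
    by split=> //; left.
  by split; [apply: drop_la | right].
have UL : uniq L.
  rewrite cat_uniq !map_inj_uniq ?drop_uniq ?Ula ?andbT //;
    try exact: opair_graph_inj.
  apply/hasPn => _ /mapP[a /drop_la al ->]; apply/negP => /mapP[c _] /opair_inj[<-].
  by move=> /esym; case: (fla a al).
have LY u : u \in L -> u ∊ Y.
  rewrite mem_cat => /orP[] /mapP[c cl ->]; first by case: (fla c cl).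
  by case: (fla c (drop_la _ cl)).
have a0_fxy := fxy a0 (mem_head _ _).
pose s z := setl (opair a0 z :: L).
have in_s z a x : opair a x ∊ s z <-> (a = a0 /\ x = z) \/ opair a x \in L.
  rewrite in_setl in_cons; split=> [/orP[/eqP/opair_inj[-> ->]|]|[ [-> ->]|->] ];
    rewrite ?eqxx ?orbT; auto.
have sY z : opair a0 z ∊ Y -> subset (s z) Y.
  by move=> zY u /in_setl; rewrite in_cons => /predU1P[->|/LY].
have s_m z : card m (s z).
  have <- : size (opair a0 z :: L) = m.
    have jE := prednK j0; have j_la : j.-1 <= size la by rewrite -ltnS jE sla.
    apply/eqP; rewrite /= size_cat !size_map size_drop -(eqn_add2r j) mj -sla.
    by rewrite -[X in _ + X]jE addSn addnS -addnA subnK // addnn doubleS.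
  by apply: card_setl; rewrite /= UL andbT; apply/negP => /in_L[]; rewrite (negPf a0la).
have fs z : z = fx a0 \/ z = fy a0 -> opair a0 z ∊ Y ->
    fibre_system (s z) (setl (a0 :: la)).
  move=> ez zY; split; first by move=> u /(sY _ zY)/YX.
  split; first by rewrite -sla; apply: (card_setl (l := a0 :: la)); rewrite /= a0la.
  split.
    move=> a; rewrite in_setl in_cons; split=> [/predU1P[->|al]|[x] ].
    - by exists z; apply/in_s; left.
    - exists (fx a); apply/in_s; right; rewrite mem_cat; apply/orP; left.
      by apply/mapP; exists a.
    - by case/in_s=> [ [-> _]|/in_L[-> _] ]; rewrite ?eqxx ?orbT.
  move=> a; have fib x : opair a x ∊ s z -> x = fx a \/ x = fy a.
    by case/in_s=> [ [-> ->]|/in_L[] ].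
  move=> x y w /fib ex /fib ey /fib ew.
  case: ex ey ew => -> [] -> [] ->; auto.
have [nfxy xY yY] := a0_fxy.
(* Both sets lie in [Y] and have the same base, so they coincide although they differ over [a0]. *)
have eq_s : s (fx a0) = s (fy a0).
  by apply: polyY (fs _ _ xY) (fs _ _ yY); auto.
have : opair a0 (fx a0) ∊ s (fy a0) by rewrite -eq_s; apply/in_s; left.
by case/in_s=> [ []//|/in_L[] ]; rewrite (negPf a0la).
Qed.

End FibreSystems.

Lemma ramsey_choice (n b j m r : nat) : 1 < n -> 0 < b -> 0 < j <= b ->
  m + j = b.*2 -> 'C(b, j) * n ^ j * 'C(n, 2) ^ (b - j) <= r ->
  ramsey m r -> choice_minus n.
Proof.
move=> n1 b0 /andP[j0 jb] mj le_r ram A [infA cA].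
have [X XE] := ex_total_space A.
exact (choice_fibre_systems XE cA n1 b0 jb mj le_r j0 ram infA).
Qed.

(** For [b = 1] and [j = 0] a class consists of at most three pairs inside one fibre, so 3 bounds
    its size, and two distinct pairs in a fibre cannot both lie in [Y]. *)
Lemma ramsey23_choice3 : ramsey 2 3 -> choice_minus 3.
Proof.
move=> ram A [infA cA]; have [X XE] := ex_total_space A.
have [Y [YX infY polyY] ] :=
  @rainbow_fibre_systems A X 3 1 0 2 3 XE cA isT isT erefl isT ram infA.
have notall a : a ∊ A -> ~ forall x, x ∊ a -> opair a x ∊ Y.
  move=> aA aY; have /cardP[l [+ + aE] ] := cA a aA.
  case: l aE => [|x [|y [|z [|? ?] ] ] ] //= aE; rewrite !inE negb_or andbT.
  move=> /andP[/andP[/eqP xy /eqP xz] /eqP yz] _.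
  have [xa ya za] : [/\ x ∊ a, y ∊ a & z ∊ a].
    by split; rewrite aE !inE !eqxx ?orbT.
  pose s u v := setl [:: opair a u; opair a v].
  have in_s u v c w : opair c w ∊ s u v <-> c = a /\ (w = u \/ w = v).
    rewrite in_setl !inE; split=> [|[->] [] ->]; rewrite ?eqxx ?orbT //.
    by case/orP=> /eqP/opair_inj[-> ->]; auto.
  have s2 u v : u <> v -> card 2 (s u v).
    move=> uv; apply: (card_setl (l := [:: opair a u; opair a v])).
    by rewrite /= inE andbT; apply/eqP => /opair_inj[].
  have sY u v : u ∊ a -> v ∊ a -> subset (s u v) Y.
    by move=> ua va w /in_setl; rewrite !inE => /orP[] /eqP ->; apply: aY.
  have fs u v : u ∊ a -> v ∊ a -> fibre_system X 1 (s u v) (setl [:: a]).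
    move=> ua va; split; first by move=> w /(sY _ _ ua va)/YX.
    split; first exact: (card_setl (l := [:: a])).
    split=> [c|c p q w /in_s[_ ep] /in_s[_ eq] /in_s[_ ew] ].
      rewrite in_setl inE; split=> [/eqP->|[w /in_s[-> _] ] ]; last exact: eqxx.
      by exists u; apply/in_s; auto.
    by case: ep eq ew => -> [] -> [] ->; auto.
  have eq_s : s x y = s x z.
    by apply: polyY (fs _ _ xa ya) (fs _ _ xa za); auto.
  have : opair a y ∊ s x z by rewrite -eq_s; apply/in_s; auto.
  by case/in_s=> _ [/esym|].
have [B [BE infB] ] := infinite_support XE cA YX infY.
exists B; split; first by move=> a /BE[].
split=> //.
(* The first case serves fibres with one point in [Y], the second those with two, where the
   remaining point is chosen. *)
apply: (@choice_from (fun a x =>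
  (opair a x ∊ Y /\ forall y, opair a y ∊ Y -> y = x) \/
  (~ opair a x ∊ Y /\ exists y z, y <> z /\ opair a y ∊ Y /\ opair a z ∊ Y))).
- by dfn.
- move=> a /BE[aA [u uY] ].
  have [uniq_u|] := pselect (forall y, opair a y ∊ Y -> y = u).
    exists u; split; last by left.
    by have /(in_total_space _ _ XE)[] := YX _ uY.
  move=> nuniq; have [v [vY vu] ] : exists v, opair a v ∊ Y /\ v <> u.
    apply: contrapT => H; apply: nuniq => y yY; apply: contrapT => yu.
    by apply: H; exists y.
  have [w [wa wY] ] : exists w, w ∊ a /\ ~ opair a w ∊ Y.
    apply: contrapT => H; apply: (notall a aA) => x xa; apply: contrapT => xY.
    by apply: H; exists x.
  by exists w; split=> //; right; split=> //; exists v, u.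
- move=> a x y /BE[aA _] xa ya [ [xY xu]|[xY [p [q [pq [pY qY] ] ] ] ] ].
    case=> [ [yY _]|[_ [p [q [pq [pY qY] ] ] ] ] ]; first exact: xu.
    by case: pq; rewrite (xu _ pY) (xu _ qY).
  case=> [ [_ yu]|[yY _] ]; first by case: pq; rewrite (yu _ pY) (yu _ qY).
  apply: contrapT => yx; have /cardP[l [_ sl lE] ] := cA a aA.
  have [pa qa] : p ∊ a /\ q ∊ a.
    by split; [have /(in_total_space _ _ XE)[] := YX _ pY
             | have /(in_total_space _ _ XE)[] := YX _ qY].
  (* Two points outside [Y] and two inside would be four points in a three-element fibre. *)
  have : size [:: x; y; p; q] <= size l.
    apply: uniq_leq_size.
      rewrite /= !inE !negb_or andbT -!andbA; do ?[apply/andP; split]; apply/eqP.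
      - by move=> /esym.
      - by move=> e; apply: xY; rewrite e.
      - by move=> e; apply: xY; rewrite e.
      - by move=> e; apply: yY; rewrite e.
      - by move=> e; apply: yY; rewrite e.
      - exact: pq.
    by move=> u; rewrite !inE => /or4P[] /eqP ->; apply/lE.
  by rewrite sl.
Qed.

End SetTheory.

(** Completeness reduces provability to models of [ZF], where the two formulas denote [ramsey] and
    [choice_minus]. *)
Lemma ZF_proves (m n c : nat) :
  (forall (M : countType) (E : M -> M -> Prop) (rho0 : nat -> M)
     (modelZF : forall q rho, ZF q -> sat E rho q),
     ramsey rho0 modelZF m n -> choice_minus rho0 modelZF c) ->
  ZF ⊢ (RRT m n ⇒ AC_minus c)%F.
Proof.
move=> H; apply: completeness ZF_closed _ => M E modelZF rho.
apply/(denotes_imp (denotes_RRT rho modelZF rho m n)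
                   (denotes_AC_minus rho modelZF rho c)).
exact: H.
Qed.

Theorem proposition3p3 (m n k : nat) (hm : 1 < m) (hn : 1 < n) (hk : 0 < k) :
  [/\ ZF ⊢ (RRT m n ⇒ AC_minus 2)%F,
      forall r : nat, 'C(n, 2) ^ k * n * (k + 1) <= r ->
        ZF ⊢ (RRT (2 * k + 1) r ⇒ AC_minus n)%F,
      forall r : nat, 'C(n, 2) ^ (k - 1) * n ^ 2 * 'C(k + 1, 2) <= r ->
        ZF ⊢ (RRT (2 * k) r ⇒ AC_minus n)%F
    & ZF ⊢ (RRT 2 3 ⇒ AC_minus 3)%F].
Proof.
split.
- apply: ZF_proves => M E rho0 modelZF; apply: ramsey_choice2 => //.
  exact: ltnW.
- move=> r le_r; apply: ZF_proves => M E rho0 modelZF.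
  apply: (@ramsey_choice _ _ _ _ n (k + 1) 1) => //.
  + by rewrite addn1.
  + by rewrite addn1.
  + by rewrite mul2n !addn1 doubleS.
  + by rewrite bin1 expn1 addnK mulnC (mulnC (k + 1)) mulnA.
- move=> r le_r; apply: ZF_proves => M E rho0 modelZF.
  (* The condition [j <= b] reads [2 <= k + 1] and holds because [0 < k]. *)
  apply: (@ramsey_choice _ _ _ _ n (k + 1) 2) => //.
  + by rewrite addn1.
  + by rewrite addn1.
  + by rewrite mul2n addn1 doubleS addn2.
  + have -> : k + 1 - 2 = k - 1 by rewrite addn1 subSS.
    by rewrite mulnC (mulnC 'C(k + 1, 2)) mulnA.
- by apply: ZF_proves => M E rho0 modelZF; apply: ramsey23_choice3.
Qed.
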